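(* Let $n\ge 2$, $d\ge 1$, and let $K$ be the minimum number of generators of the set of $n$-antisymmetric polynomials as a module over the ring of totally symmetric polynomials. There are $n$-antisymmetric homogeneous polynomials $f_1,\dots,f_K\in\mathbb{R}[\boldsymbol{x}_1,\dots,\boldsymbol{x}_n]$ of degree at most $\binom{n}{2}$, depending only on $n$ and $d$, such that the following holds. For every integer $k\ge0$, every compact $\Omega\subset\mathbb{R}^d$, every $n$-antisymmetric $\mathcal{C}^k$ function $f:\Omega^n\to\mathbb{R}$ and every $\epsilon>0$, there exist totally symmetric polynomials $u_1,\dots,u_K\in\mathbb{R}[\boldsymbol{x}_1,\dots,\boldsymbol{x}_n]$ such that $$\Big\|f-\sum_{i=1}^K u_i f_i\Big\|_{\mathcal{C}^k(\Omega^n)}<\epsilon .$$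
   Context: Points of $(\mathbb{R}^d)^n$ are written $\boldsymbol{x}=(\boldsymbol{x}_1,\dots,\boldsymbol{x}_n)$ with $\boldsymbol{x}_i\in\mathbb{R}^d$, and $\mathbb{R}[\boldsymbol{x}_1,\dots,\boldsymbol{x}_n]$ is the ring of real polynomials in the $dn$ coordinates. For $\sigma\in\mathcal{S}_n$ (symmetric group), $\sigma.\boldsymbol{x}:=(\boldsymbol{x}_{\sigma(1)},\dots,\boldsymbol{x}_{\sigma(n)})$. A function $f$ is totally symmetric if $f(\sigma.\boldsymbol{x})=f(\boldsymbol{x})$, and $n$-antisymmetric if $f(\sigma.\boldsymbol{x})=\mathrm{sgn}(\sigma)f(\boldsymbol{x})$, for all $\sigma\in\mathcal{S}_n$ and all $\boldsymbol{x}$ in its domain. For compact $V\subset(\mathbb{R}^d)^n$, pick any open set $U$ with $V\subset U\subseteq(\mathbb{R}^d)^n$ and put $\mathcal{C}^k(V)=\{F|_V: F\in\mathcal{C}^k(U)\}$, where $\mathcal{C}^k(U)$ is the set of $k$ times continuously differentiable real functions on $U$; this space is regarded as independent of the choice of $U$. The norm is given by the maxima of the continuous derivatives up to order $k$, restricted to $V$: $$\|p\|_{\mathcal{C}^k(V)}:=\sum_{|\alpha|\le k}\max_{\boldsymbol{x}\in V}|(D^\alpha p)(\boldsymbol{x})|,$$ with $\alpha\in\mathbb{Z}_{\ge0}^{dn}$ a multi-index.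
   Formalization: On a general compact Ω^n the derivatives of f depend on its C^k extension; the norm is taken for any extension whose derivatives up to order k on Ω^n satisfy the antisymmetry relations. Such an extension is proved to exist; for other extensions the claim fails (e.g. Ω a point). *)

(* Defs.v *)
From HB Require Import structures.
From mathcomp Require Import all_boot all_order all_algebra all_fingroup.
(* The notations of mpoly clash with those of MathComp-Analysis:
   [mpoly m R] is {mpoly R[m]}, [bmultinom m b] is 'X_{1..m < b}, and
   [p \is ishomog1 e mdeg] is [p \is e.-homog]. *)
From mathcomp Require Import -(notations) mpoly.
From mathcomp Require Import all_classical all_reals all_analysis.
Import numFieldNormedType.Exports.

Set Implicit Arguments.
Unset Strict Implicit.
Unset Printing Implicit Defensive.

Import Order.TTheory GRing.Theory Num.Theory.
Local Open Scope classical_set_scope.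
Local Open Scope ring_scope.

(* A point x = (x_1, ..., x_n) of (R^d)^n is an n x d matrix whose i-th row is
   x_i. Then [row_perm s x] is (x_{s(1)}, ..., x_{s(n)}), and the dn scalar
   coordinates are indexed by 'I_(n * d) through [mxvec]. *)

Definition cart_pow (R : realType) (n d : nat) (Omega : set 'rV[R]_d) :
    set 'M[R]_(n, d) :=
  [set x | forall i, Omega (row i x)].
Arguments cart_pow {R} n {d} Omega.

Definition totally_symmetric_on (R : realType) (n d : nat)
    (A : set 'M[R]_(n, d)) (f : 'M[R]_(n, d) -> R) : Prop :=
  forall (s : 'S_n) x, A x -> f (row_perm s x) = f x.

Definition antisymmetric_on (R : realType) (n d : nat)
    (A : set 'M[R]_(n, d)) (f : 'M[R]_(n, d) -> R) : Prop :=
  forall (s : 'S_n) x, A x -> f (row_perm s x) = (-1) ^+ s * f x.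

Definition peval (R : realType) (n d : nat) (p : mpoly (n * d) R)
    (x : 'M[R]_(n, d)) : R :=
  meval (mxvec x 0) p.

Definition symmetric_poly (R : realType) (n d : nat) (p : mpoly (n * d) R) :
    Prop :=
  totally_symmetric_on [set: 'M[R]_(n, d)] (peval p).
Arguments symmetric_poly {R} n d p.

Definition antisymmetric_poly (R : realType) (n d : nat)
    (p : mpoly (n * d) R) : Prop :=
  antisymmetric_on [set: 'M[R]_(n, d)] (peval p).
Arguments antisymmetric_poly {R} n d p.

Definition generates_antisymmetric (R : realType) (n d m : nat)
    (f : 'I_m -> mpoly (n * d) R) : Prop :=
  (forall i, antisymmetric_poly n d (f i)) /\
  forall g, antisymmetric_poly n d g ->
    exists u : 'I_m -> mpoly (n * d) R,
      (forall i, symmetric_poly n d (u i)) /\ g = \sum_(i < m) u i * f i.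
Arguments generates_antisymmetric {R} n d {m} f.

Definition min_num_generators (R : realType) (n d K : nat) : Prop :=
  (exists f : 'I_K -> mpoly (n * d) R, generates_antisymmetric n d f) /\
  forall m (f : 'I_m -> mpoly (n * d) R),
    generates_antisymmetric n d f -> (K <= m)%N.

Definition basis_vec (R : realType) (n d : nat) (v : 'I_(n * d)) :
    'M[R]_(n, d) :=
  vec_mx (delta_mx 0 v).

Definition partial (R : realType) (n d : nat) (v : 'I_(n * d))
    (F : 'M[R]_(n, d) -> R) : 'M[R]_(n, d) -> R :=
  fun x => 'D_(basis_vec R v) F x.

(* D^a F. The partial derivatives are taken in a fixed order of the
   coordinates, which is immaterial at points near which F is C^|a|. *)
Definition partials (R : realType) (n d : nat) (a : 'I_(n * d) -> nat)
    (F : 'M[R]_(n, d) -> R) : 'M[R]_(n, d) -> R :=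
  foldr (fun v G => iter (a v) (partial v) G) F (enum 'I_(n * d)).

(* F is in C^k(U), for U open; the values of F outside U are irrelevant. *)
Fixpoint Ck (R : realType) (n d k : nat) (U : set 'M[R]_(n, d))
    (F : 'M[R]_(n, d) -> R) : Prop :=
  (forall x, U x -> {for x, continuous F}) /\
  if k is k'.+1 then
    forall v : 'I_(n * d),
      (forall x, U x -> derivable F x (basis_vec R v)) /\ Ck k' U (partial v F)
  else True.

(* F, of class C^k on an open neighbourhood of V, has f as restriction to V. *)
Definition Ck_extension (R : realType) (n d k : nat) (V : set 'M[R]_(n, d))
    (f F : 'M[R]_(n, d) -> R) : Prop :=
  exists U : set 'M[R]_(n, d),
    [/\ open U, V `<=` U, Ck k U F & forall x, V x -> F x = f x].

Definition Ck_on (R : realType) (n d k : nat) (V : set 'M[R]_(n, d))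
    (f : 'M[R]_(n, d) -> R) : Prop :=
  exists F, Ck_extension k V f F.

(* ||F||_{C^k(V)}, for F of class C^k near the compact set V, so that each
   supremum is a maximum (and is 0 if V is empty). *)
Definition Ck_norm (R : realType) (n d k : nat) (V : set 'M[R]_(n, d))
    (F : 'M[R]_(n, d) -> R) : R :=
  \sum_(a : bmultinom (n * d) k.+1) sup [set `|partials a F x| | x in V].

(* The derivatives of order <= k of F on V satisfy the relations obtained by
   differentiating F(s.x) = sgn(s) F(x).

   The norm of a C^k function f : V -> R involves derivatives on V of an
   extension F of f. If V is the closure of its interior they depend on f only,
   and this condition holds for every F as soon as f is antisymmetric. For
   other V (e.g. a point) they depend on F, and an extension of an
   antisymmetric f can be approximated in C^k norm on V by antisymmetric
   polynomials only if it satisfies this condition. *)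
Definition antisymmetric_derivatives (R : realType) (n d k : nat)
    (V : set 'M[R]_(n, d)) (F : 'M[R]_(n, d) -> R) : Prop :=
  forall a : bmultinom (n * d) k.+1, forall (s : 'S_n) x, V x ->
    partials a (fun y => F (row_perm s y)) x = (-1) ^+ s * partials a F x.

(* Main.v *)
Require Import Defs.
From HB Require Import structures.
From mathcomp Require Import all_boot all_order all_algebra all_fingroup.
From mathcomp Require Import -(notations) mpoly.
From mathcomp Require Import all_classical all_reals all_analysis.
From mathcomp Require Import zify ring lra.
Import numFieldNormedType.Exports.
Import Order.TTheory GRing.Theory Num.Theory.
Local Open Scope classical_set_scope.
Local Open Scope ring_scope.

Set Implicit Arguments.
Unset Strict Implicit.
Unset Printing Implicit Defensive.

(* Algebra. Averaging over S_n turns every spanning set of the polynomial ring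
   over the symmetric polynomials into a generating set of the antisymmetric
   ones, so it is enough that the monomials of degree at most C(n, 2) span. With
   particles numbered from 0, a monomial of larger degree has degree at least
   k = i + 1 in the coordinates of some particle i. By polarization, a product
   of k of these coordinates is a combination of powers z_i^k, where
   z_j = sum_c t_c x_(j,c); and modulo symmetric polynomials of positive degree
   the complete symmetric function h_k(z_i, ..., z_(n-1)) vanishes, which
   rewrites z_i^k in terms that involve particle i less and later particles
   more. A graded Nakayama argument then shows that an irredundant homogeneous
   generating family is no longer than any other generating family.

   Analysis. Multiplying by a C^k cutoff reduces C^k approximation on a compact
   set to functions with compact support, whose Bernstein polynomials converge
   together with all derivatives: the derivatives are Bernstein sums of finite
   differences, and these are derivatives at nearby points by the mean value
   theorem. Antisymmetrizing the approximating polynomial does not increase the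
   error, and the result lies in the module generated by the f_i. *)

(** * Spanning over the symmetric polynomials *)

Section CompleteSymmetricRelation.
Variables (A : comNzRingType) (n : nat) (z : 'I_n -> A).

(** Inverse of [1 - z j *: 'X] modulo ['X^(k.+1)]. For r <= k, the coefficient of ['X^r] in a
    product of such series is the complete symmetric function h_r of the [z j] involved. *)
Definition geom_series (k : nat) (j : 'I_n) : {poly A} :=
  \poly_(b < k.+1) z j ^+ b.

(** Its coefficients are, up to sign, the elementary symmetric functions of [z]. *)
Definition elem_series : {poly A} := \prod_j (1 - z j *: 'X).

Lemma geom_seriesM k j :
  geom_series k j * (1 - z j *: 'X) = 1 - (z j ^+ k.+1) *: 'X^(k.+1).
Proof.
rewrite /geom_series poly_def.
transitivity ((1 - z j *: 'X) * (\sum_(b < k.+1) (z j *: 'X) ^+ b)).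
  rewrite mulrC; congr (_ * _); apply: eq_bigr => b _.
  by rewrite exprZn.
by rewrite -exprZn -[1 in RHS](expr1n _ k.+1) subrXX; congr (_ * _);
  apply: eq_bigr => b _; rewrite expr1n mul1r.
Qed.

Lemma size_prod_linear (P : pred 'I_n) :
  (size (\prod_(j | P j) (1 - z j *: 'X)%R)%R <= #|P|.+1)%N.
Proof.
rewrite -sum1_card; elim/big_ind2 : _ => [|m1 p1 m2 p2 h1 h2|j _].
- by rewrite size_poly1.
- apply: leq_trans (size_polyMleq _ _) _.
  move: h1 h2; case: (size p1) (size p2) => [|a] [|b] //=; lia.
apply: leq_trans (size_polyD _ _) _; rewrite geq_max size_poly1 size_polyN /=.
by apply: leq_trans (size_scale_leq _ _) _; rewrite size_polyX.
Qed.

(* All the geometric series are inverses of linear factors modulo 'X^(k.+1); what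
   is left of elem_series has degree i < k, so the coefficient of 'X^k is 0. *)
Lemma expr_complete_symmetric (i : 'I_n) (k : nat) : (i < k)%N ->
  z i ^+ k =
    - (\sum_(b < k) z i ^+ b *
          (\prod_(j < n | (i < j)%N) geom_series k j)`_(k - b))
    - \sum_(a < k) elem_series`_a.+1 *
          (\prod_(j < n | (i <= j)%N) geom_series k j)`_(k - a.+1).
Proof.
move=> lt_ik; set H := \prod_(j < n | (i < j)%N) _.
set HH := \prod_(j < n | (i <= j)%N) _.
have HHE : HH = geom_series k i * H.
  rewrite /HH (bigD1 i) //=; congr (_ * _); apply: eq_bigl => j.
  by rewrite ltn_neqAle andbC eq_sym.
have trunc (P : pred 'I_n) : exists r : {poly A},
    \prod_(j < n | P j) (geom_series k j * (1 - z j *: 'X)) = 1 + r * 'X^(k.+1).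
  elim/big_ind : _ => [|_ _ [r ->] [r' ->]|j _].
  - by exists 0; rewrite mul0r addr0.
  - exists (r + r' + r * 'X^(k.+1) * r').
    by ring.
  - by exists (- (z j ^+ k.+1)%:P); rewrite geom_seriesM mulNr mul_polyC.
have E0 : elem_series`_0 = 1.
  rewrite -horner_coef0 /elem_series horner_prod big1 // => j _.
  by rewrite hornerD hornerN hornerZ hornerX hornerC mulr0 subr0.
have G0 j : (geom_series k j)`_0 = 1 by rewrite coef_poly /= expr0.
have H0 : H`_0 = 1.
  rewrite -horner_coef0 horner_prod big1 // => j _.
  by rewrite horner_coef0 G0.
have coefHH : (HH * elem_series)`_k = 0.
  rewrite /elem_series (bigID (fun j : 'I_n => (i <= j)%N)) /= mulrA -big_split /=.
  have [r ->] := trunc (fun j : 'I_n => (i <= j)%N).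
  rewrite mulrDl mul1r mulrAC coefD coefMXn ltnS leqnn addr0.
  apply: nth_default; apply: leq_trans (size_prod_linear _) _.
  have -> : #|(fun j : 'I_n => ~~ (i <= j)%N)| = i; last exact: lt_ik.
  rewrite -[RHS]card_ord -sum1_card; under eq_bigl do rewrite unfold_in -ltnNge.
  rewrite (big_ord_narrow (ltnW (ltn_ord i))) /= -sum1_card.
  by [].
(* Separating the factor of index i isolates [z i ^+ k], whose cofactor is h_0 = 1. *)
have HHk : HH`_k = z i ^+ k + \sum_(b < k) z i ^+ b * H`_(k - b).
  rewrite HHE coefM big_ord_recr /= subnn H0 mulr1 addrC.
  rewrite coef_poly ltnSn; congr (_ + _); apply: eq_bigr => b _.
  by rewrite coef_poly ltnS ltnW.
move: coefHH; rewrite mulrC coefM big_ord_recl E0 mul1r subn0 HHk.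
rewrite -addrA => /eqP; rewrite addr_eq0 => /eqP ->.
by rewrite opprD; congr (_ - _); apply: eq_bigr => a _; rewrite /bump /= add1n.
Qed.

End CompleteSymmetricRelation.

(** * The polarization identity *)

Section Polarization.
Variable (A : comNzRingType).

Fixpoint iterdiff (s : seq A) (F : A -> A) (y : A) : A :=
  if s is l :: s' then iterdiff s' F (y + l) - iterdiff s' F y else F y.

Lemma iterdiffD s F G y :
  iterdiff s (fun x => F x + G x) y = iterdiff s F y + iterdiff s G y.
Proof. by elim: s y => //= l s IH y; rewrite !IH opprD addrACA. Qed.

Lemma iterdiffZ s c F y :
  iterdiff s (fun x => c * F x) y = c * iterdiff s F y.
Proof. by elim: s y => //= l s IH y; rewrite !IH mulrBr. Qed.

Lemma iterdiff0 s y : iterdiff s (fun=> 0) y = 0.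
Proof. by elim: s y => //= l s IH y; rewrite !IH subrr. Qed.

Lemma iterdiff_sum s m (F : 'I_m -> A -> A) y :
  iterdiff s (fun x => \sum_(j < m) F j x) y = \sum_(j < m) iterdiff s (F j) y.
Proof.
elim: m F => [|m IH] F.
  rewrite big_ord0 -[RHS](iterdiff0 s y); congr (iterdiff s _ y).
  by apply/funext => x; rewrite big_ord0.
rewrite big_ord_recl -IH -iterdiffD; congr (iterdiff s _ y).
by apply/funext => x; rewrite big_ord_recl.
Qed.

Lemma iterdiff_shift s F l y :
  iterdiff s F (y + l) = iterdiff s (fun x => F (x + l)) y.
Proof. by elim: s y => //= a s IH y; rewrite !IH addrAC IH. Qed.

(** Each difference lowers the degree in x by one, so after e of them only e! times the product of
    the steps is left. For e = [size s] this is polarization: the left side is a signed sum of e-th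
    powers of y plus partial sums of [s]. *)
Lemma iterdiff_expr s e y : (e <= size s)%N ->
  iterdiff s (fun x => x ^+ e) y =
  if e == size s then e`!%:R * \prod_(l <- s) l else 0.
Proof.
elim: s e y => [|l s IH] e y /=.
  by rewrite leqn0 => /eqP ->; rewrite eqxx big_nil expr0 mulr1.
case: e => [|e] les /=.
  rewrite -[iterdiff s _ (y + l)]/(iterdiff s (fun=> 1) (y + l)).
  by rewrite iterdiff_shift subrr.
rewrite iterdiff_shift; apply/eqP; rewrite subr_eq; apply/eqP.
(* The top power of x in (x + l)^(e+1) is split off, since it cancels against the unshifted term. *)
transitivity (iterdiff s (fun x => \sum_(j < e.+1) 'C(e.+1, j)%:R * l ^+ (e.+1 - j) * x ^+ j) y
   + iterdiff s (fun x => x ^+ e.+1) y).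
  rewrite -iterdiffD; congr (iterdiff s _ y); apply/funext => x.
  rewrite addrC exprDn big_ord_recr /= subnn binn mul1r mulr1n; congr (_ + _).
  by apply: eq_bigr => j _; rewrite -mulr_natl mulrA.
(* A power x^j with j < e has degree below the number of remaining differences, so only j = e
   survives. *)
congr (_ + _); rewrite iterdiff_sum big_ord_recr /= big1 ?add0r; last first.
  move=> j _; rewrite iterdiffZ (IH j); last by have := ltn_ord j; lia.
  by rewrite ltn_eqF ?mulr0 //; have := ltn_ord j; lia.
rewrite iterdiffZ IH // eqSS; case: ifP => [/eqP e_s|]; last by rewrite mulr0.
rewrite big_cons factS subSnn expr1 binSn natrM; ring.
Qed.

(** The iterated difference is a signed sum of values of [F] at sums of [y] and some letters of
    [s]. *)
Lemma iterdiff_closed (L W : A -> Prop) s F y :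
  (forall a b, L a -> L b -> L (a + b)) -> (forall a b, W a -> W b -> W (a - b)) ->
  (forall x, L x -> W (F x)) -> (forall l, l \in s -> L l) -> L y ->
  W (iterdiff s F y).
Proof.
move=> LD WB WF; elim: s y => [|l s IH] y Ls Ly /=; first exact: WF.
have Ls' : forall l, l \in s -> L l by move=> a sa; apply: Ls; rewrite inE sa orbT.
by apply: WB; apply: IH => //; apply: LD => //; apply: Ls; rewrite inE eqxx.
Qed.

End Polarization.

(** * Action of S_n on the scalar variables *)

Section VariableIndices.
Variables (n d : nat).

Definition vindex (v : 'I_(n * d)) : 'I_n * 'I_d :=
  enum_val (cast_ord (esym (mxvec_cast n d)) v).

Lemma vindexK i j : vindex (mxvec_index i j) = (i, j).
Proof. by rewrite /vindex /mxvec_index cast_ordK enum_rankK. Qed.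

Lemma mxvec_index_vindex v : mxvec_index (vindex v).1 (vindex v).2 = v.
Proof. by case/mxvec_indexP: v => i j; rewrite vindexK. Qed.

Lemma vperm_inj (s : 'S_n) :
  injective (fun v => mxvec_index (s (vindex v).1) (vindex v).2).
Proof.
move=> u v /(congr1 vindex); rewrite !vindexK => -[/perm_inj e1 e2].
by rewrite -(mxvec_index_vindex u) -(mxvec_index_vindex v) e1 e2.
Qed.

Definition vperm (s : 'S_n) : 'S_(n * d) := perm (@vperm_inj s).

Lemma vpermE s i j : vperm s (mxvec_index i j) = mxvec_index (s i) j.
Proof. by rewrite permE vindexK. Qed.

Lemma vpermM s t : vperm (s * t)%g = (vperm s * vperm t)%g.
Proof.
by apply/permP => v; case/mxvec_indexP: v => i j; rewrite permM !vpermE permM.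
Qed.

Lemma sum_vindex (F : 'I_(n * d) -> nat) :
  (\sum_v F v = \sum_i \sum_c F (mxvec_index i c))%N.
Proof.
rewrite pair_big /= (reindex (fun p : 'I_n * 'I_d => mxvec_index p.1 p.2)) //=.
by exists vindex => [[i j] _|v _]; rewrite ?vindexK ?mxvec_index_vindex.
Qed.

End VariableIndices.

(** * Monomials of degree at most C(n, 2) span *)

Section Spanning.
Variables (R : numFieldType) (n d : nat).
Local Notation A := (mpoly (n * d) R).
Local Notation mon := (multinom (n * d)).
Local Notation mX m := (mpolyX R m).
Local Notation Xv v := (mpolyX R (mnm1 v)).
Local Notation D0 := 'C(n, 2).

Definition invariant (p : A) := forall s : 'S_n, msym (vperm d s) p = p.

Definition spanned (p : A) := exists u : bmultinom (n * d) D0.+1 -> A,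
  (forall b, invariant (u b)) /\ p = \sum_b u b * mX b.

Lemma invariantD p q : invariant p -> invariant q -> invariant (p + q).
Proof. by move=> hp hq s; rewrite msymD hp hq. Qed.
Lemma invariantM p q : invariant p -> invariant q -> invariant (p * q).
Proof. by move=> hp hq s; rewrite msymM hp hq. Qed.
Lemma invariantN p : invariant p -> invariant (- p).
Proof. by move=> hp s; rewrite msymN hp. Qed.
Lemma invariantC c : invariant (mpolyC _ c).
Proof. by move=> s; rewrite -[mpolyC _ c]mulr1 mul_mpolyC msymZ msym1. Qed.
Lemma invariant0 : invariant 0.
Proof. by move=> s; rewrite msym0. Qed.

Lemma spannedD p q : spanned p -> spanned q -> spanned (p + q).
Proof.
move=> [u [hu ->]] [v [hv ->]]; exists (fun b => u b + v b).
split=> [b|]; first exact: invariantD.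
by rewrite -big_split; apply: eq_bigr => b _; rewrite mulrDl.
Qed.

Lemma spannedM c p : invariant c -> spanned p -> spanned (c * p).
Proof.
move=> hc [u [hu ->]]; exists (fun b => c * u b).
split=> [b|]; first exact: invariantM.
by rewrite mulr_sumr; apply: eq_bigr => b _; rewrite mulrA.
Qed.

Lemma spannedN p : spanned p -> spanned (- p).
Proof.
move=> hp; rewrite -mulN1r; apply: spannedM hp.
by rewrite -mpolyC1; apply: invariantN; apply: invariantC.
Qed.

Lemma spanned0 : spanned 0.
Proof.
exists (fun=> 0); split=> [b|]; first exact: invariant0.
by rewrite big1 // => b _; rewrite mul0r.
Qed.

Lemma spanned_sum (I : Type) (r : seq I) (P : pred I) (F : I -> A) :
  (forall i, P i -> spanned (F i)) -> spanned (\sum_(i <- r | P i) F i).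
Proof.
by move=> h; apply: (big_ind spanned); [exact: spanned0|exact: spannedD|].
Qed.

Lemma spannedX (m : mon) : (mdeg m <= D0)%N -> spanned (mX m).
Proof.
rewrite -ltnS => hm; exists (fun b => mpolyC _ (b == BMultinom hm)%:R).
split=> [b|]; first exact: invariantC.
rewrite (bigD1 (BMultinom hm)) //= eqxx mpolyC1 mul1r big1 ?addr0 //.
by move=> b /negbTE ->; rewrite mpolyC0 mul0r.
Qed.

(* Moving variables from a particle to later ones decreases this weight. *)
Definition tail_weight (m : mon) : nat :=
  (\sum_v m v * (n - (vindex v).1))%N.

Lemma tail_weightD m1 m2 :
  tail_weight (mnm_add m1 m2) = (tail_weight m1 + tail_weight m2)%N.
Proof.
by rewrite /tail_weight -big_split; apply: eq_bigr => v _; rewrite mnmDE mulnDl.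
Qed.

Lemma tail_weight1 v : tail_weight (mnm1 v) = (n - (vindex v).1)%N.
Proof.
rewrite /tail_weight (bigD1 v) //= mnm1E eqxx mul1n big1 ?addn0 // => u.
by rewrite mnm1E eq_sym => /negbTE ->; rewrite mul0n.
Qed.

(** Degree and tail weight, ordered lexicographically, form the measure of the induction in
    [spanned_mpolyX]. Both are additive under products, so bounds can be checked factor by
    factor. *)
Definition bounded_by (D w : nat) (p : A) :=
  forall m, m \in msupp p -> (mdeg m <= D)%N /\ (tail_weight m <= w)%N.

Lemma bounded_byW D w D' w' p : bounded_by D w p ->
  (D <= D')%N -> (w <= w')%N -> bounded_by D' w' p.
Proof. by move=> h hD hw m /h [h1 h2]; split; lia. Qed.

Lemma bounded_byM D w D' w' p q : bounded_by D w p -> bounded_by D' w' q ->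
  bounded_by (D + D') (w + w') (p * q).
Proof.
move=> hp hq m /msuppM_le /allpairsP [[m1 m2] /= [/hp[? ?] /hq[? ?] ->]].
by rewrite mdegD tail_weightD; split; lia.
Qed.

Lemma bounded_by_sum (I : Type) (r : seq I) (P : pred I) (F : I -> A) D w :
  (forall i, P i -> bounded_by D w (F i)) ->
  bounded_by D w (\sum_(i <- r | P i) F i).
Proof.
move=> h; elim/big_ind : _ => [|p q hp hq|//]; first by move=> m; rewrite msupp0.
by move=> m /msuppD_le; rewrite mem_cat => /orP[/hp|/hq].
Qed.

Lemma bounded_by1 : bounded_by 0 0 1.
Proof.
move=> m; rewrite -mpolyC1 msuppC oner_eq0 inE => /eqP ->.
by rewrite mdeg0 /tail_weight big1 // => v _; rewrite mnm0E mul0n.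
Qed.

Lemma bounded_by_expr D w p k : bounded_by D w p ->
  bounded_by (k * D) (k * w) (p ^+ k).
Proof.
move=> hp; elim: k => [|k IH]; first by rewrite expr0; exact: bounded_by1.
by rewrite exprS !mulSn; apply: bounded_byM.
Qed.

Lemma bounded_by_X m : bounded_by (mdeg m) (tail_weight m) (mX m).
Proof. by move=> m'; rewrite msuppX inE => /eqP ->. Qed.

(** One functional [t] is applied to every particle, so particle permutations permute these forms
    and symmetric functions of them are invariant. *)
Definition linear_form (t : 'I_d -> R) (j : 'I_n) : A :=
  \sum_c t c *: Xv (mxvec_index j c).

Lemma bounded_by_linear_form t (j : 'I_n) : bounded_by 1 (n - j) (linear_form t j).
Proof.
apply: bounded_by_sum => c _ m /msuppZ_le; rewrite msuppX inE => /eqP ->.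
by rewrite mdeg1 tail_weight1 vindexK.
Qed.

Lemma msym_linear_form s t j :
  msym (vperm d s) (linear_form t j) = linear_form t (s j).
Proof.
rewrite /linear_form raddf_sum; apply: eq_bigr => c _ /=.
rewrite msymZ msymX; congr (_ *: mpolyX _ _); apply/mnmP => v.
rewrite mnmE !mnm1E -(inj_eq (@perm_inj _ (vperm d s))) permKV vpermE.
by [].
Qed.

Lemma invariant_elem_series t a : invariant (elem_series (linear_form t))`_a.
Proof.
move=> s; rewrite -coef_map /=.
suff -> : map_poly (msym (vperm d s)) (elem_series (linear_form t)) =
  elem_series (linear_form t) by [].
rewrite /elem_series rmorph_prod /= [RHS](reindex_inj (@perm_inj _ s)) /=.
apply: eq_bigr => j _; rewrite rmorphB /= rmorph1 map_polyZ /= map_polyX.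
by rewrite msym_linear_form.
Qed.

(** The coefficient is a sum of products of r linear forms, each of degree 1 and of weight at most
    [c]. *)
Lemma bounded_by_prod_geom t k (P : pred 'I_n) c r :
  (forall j : 'I_n, P j -> (n - j <= c)%N) ->
  bounded_by r (r * c)
    (\prod_(j < n | P j) geom_series (linear_form t) k j)`_r.
Proof.
move=> hP; elim/big_ind : _ r => [|p q hp hq|j Pj] r.
- rewrite coef1; case: eqP => [->|_]; first by rewrite mul0n; exact: bounded_by1.
  by move=> m; rewrite msupp0.
- rewrite coefM; apply: bounded_by_sum => i _.
  rewrite -[in X in bounded_by X](subnKC (leq_ord i)).
  rewrite -[in X in bounded_by _ X](subnKC (leq_ord i)) mulnDl.
  exact: bounded_byM.
- rewrite coef_poly; case: ifP => [_|_]; last by move=> m; rewrite msupp0.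
  apply: (bounded_byW (@bounded_by_expr _ _ _ r (@bounded_by_linear_form t j))).
    by rewrite muln1.
  by rewrite leq_mul2l hP ?orbT.
Qed.

Lemma mnm_split_letters (m : mon) (i : 'I_n) k :
  (k <= \sum_c m (mxvec_index i c))%N ->
  exists (s : seq 'I_d) (m' : mon), [/\ size s = k,
    mdeg m = (mdeg m' + k)%N,
    tail_weight m = (tail_weight m' + k * (n - i))%N &
    mX m = mX m' * \prod_(c <- s) Xv (mxvec_index i c)].
Proof.
elim: k m => [|k IH] m hk.
  exists [::], m; split=> //; rewrite ?addn0 ?mul0n ?addn0 //.
  by rewrite big_nil mulr1.
have [c hc] : exists c, (0 < m (mxvec_index i c))%N.
  apply/existsP; rewrite -[X in is_true X]negbK negb_exists.
  apply/negP => /forallP h; move: hk; rewrite big1 // => c _.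
  by have := h c; rewrite -leqNgt leqn0 => /eqP.
pose v := mxvec_index i c; pose m1 := mnm_sub m (mnm1 v).
have mE : m = mnm_add m1 (mnm1 v).
  apply/mnmP => u; rewrite mnmDE mnmBE mnm1E; case: eqP => [<-|_]; last by rewrite subn0 addn0.
  by rewrite subnK.
have [|s [m' [ss dm wm Xm]]] := IH m1.
  have e : (\sum_(c' < d | c' != c) m1 (mxvec_index i c') =
            \sum_(c' < d | c' != c) m (mxvec_index i c'))%N.
    apply: eq_bigr => c' ne; rewrite mnmBE mnm1E [_ == _]negbTE ?subn0 //.
    by apply: contraNneq ne => /(congr1 (@vindex n d)); rewrite !vindexK => -[->].
  move: hk; rewrite (bigD1 c) //= [X in _ -> (_ <= X)%N](bigD1 c) //= e.
  rewrite mnmBE mnm1E eqxx -/v /=; move: hc; rewrite -/v.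
  by move: (m v) (\sum_(_ < d | _) _)%N => a b; lia.
exists (c :: s), m'; split=> /=.
- by rewrite ss.
- by rewrite mE mdegD dm mdeg1; lia.
- by rewrite mE tail_weightD wm tail_weight1 vindexK /=; lia.
- by rewrite mE mpolyXD Xm big_cons -mulrA [_ * Xv _]mulrC.
Qed.

Lemma spanned_mpolyX (m : mon) : spanned (mX m).
Proof.
have [D] := ubnP (mdeg m); elim: D m => // D IHD m.
have [w] := ubnP (tail_weight m); elim: w m => // w IHw m; rewrite !ltnS => hw hD.
have [small|big] := leqP (mdeg m) D0; first exact: spannedX.
(* If every particle i had degree at most i, the total degree would be at most 0 + 1 + ... + (n - 1)
   = C(n, 2). *)
have [i hi] : exists i : 'I_n, (i < \sum_c m (mxvec_index i c))%N.
  apply/existsP; rewrite -[X in is_true X]negbK negb_exists.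
  apply/negP => /forallP h; move: big; apply/negP; rewrite -leqNgt.
  rewrite mdegE sum_vindex -(bin2_sum n) big_mkord; apply: leq_sum => i _.
  by rewrite leqNgt.
have [s [m' [ss dm wm ->]]] := mnm_split_letters hi.
set k := i.+1 in ss dm wm.
(* By polarization, the product of the k letters split off from m is a combination of k-th powers of
   linear forms of particle i, so it suffices to treat such a power times [mX m']. *)
pose L (y : A) := exists t, y = linear_form t i.
pose W (p : A) := spanned (p * mX m').
have bounded_spanned p : bounded_by D w p ->
    (forall m, m \in msupp p -> (mdeg m < D)%N \/ (tail_weight m < w)%N) ->
    spanned p.
  move=> h1 h2; rewrite (mpolyE p) big_seq; apply: spanned_sum => m1 hm1.
  rewrite -mul_mpolyC; apply: spannedM; first exact: invariantC.
  have [d1 w1] := h1 _ hm1; have [lt|lt] := h2 _ hm1; first exact: IHD.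
  by apply: IHw.
suff key : W (iterdiff [seq Xv (mxvec_index i c) | c <- s] (fun x => x ^+ k) 0).
  move: key; rewrite iterdiff_expr ?size_map ss // eqxx big_map /W => key.
  rewrite mulrC -[X in spanned X]scale1r.
  rewrite -[X in X *: _](@mulVf _ (k`!%:R)) ?pnatr_eq0 -?lt0n ?fact_gt0 //.
  rewrite -scalerA -mul_mpolyC; apply: spannedM; first exact: invariantC.
  by rewrite scaler_nat -mulr_natl mulrA.
apply: (@iterdiff_closed _ L W).
- move=> a b [t ->] [t' ->]; exists (fun c => t c + t' c).
  by rewrite -big_split; apply: eq_bigr => c _; rewrite scalerDl.
- by move=> a b ha hb; rewrite /W mulrBl; apply: spannedD ha _; apply: spannedN.
- move=> _ [t ->]; rewrite /W (expr_complete_symmetric _ (ltnSn i)) -/k.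
  rewrite mulrBl mulNr; apply: spannedD; apply: spannedN; rewrite mulr_suml.
  + apply: spanned_sum => b _.
    (* Since b < k, at least one of the k factors from particle i is traded for a later particle, of
       weight at most n - i - 1: the degree bound is kept and the weight drops. *)
    have bd : bounded_by (mdeg m) (tail_weight m).-1
        (linear_form t i ^+ b *
          (\prod_(j < n | (i < j)%N) geom_series (linear_form t) k j)`_(k - b) *
         mX m').
      rewrite dm wm addnC [(tail_weight m' + _)%N]addnC.
      have bk := ltn_ord b; have ltin := ltn_ord i.
      have hb := bounded_byM (bounded_byM
        (@bounded_by_expr _ _ _ b (@bounded_by_linear_form t i))
        (@bounded_by_prod_geom t k (fun j => (i < j)%N) (n - i).-1 (k - b)
           ltac:(move=> j /= ij; have := ltn_ord j; lia)))
        (@bounded_by_X m').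
      apply: (bounded_byW hb); first by lia.
      have e : (k * (n - i) = b * (n - i) + (k - b) * (n - i))%N.
        by rewrite -mulnDl subnKC // ltnW.
      rewrite e; have : (0 < k - b)%N by lia.
      have : (0 < n - i)%N by lia.
      case: (n - i)%N (k - b)%N => [//|x] [//|y] _ _ /=; nia.
    apply: bounded_spanned.
      by apply: (bounded_byW bd); lia.
    move=> m1 /bd [d1 w1]; right; have : (0 < tail_weight m)%N; last lia.
    by rewrite wm; have := ltn_ord i; rewrite /k; nia.
  (* The coefficient of [elem_series] is invariant and comes out of the span; what is left has
     degree lower by a + 1. *)
  + apply: spanned_sum => a _; rewrite -mulrA.
    apply: spannedM; first exact: invariant_elem_series.
    have hb := bounded_byM
        (@bounded_by_prod_geom t k (fun j => (i <= j)%N) n (k - a.+1)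
           ltac:(move=> j /= ij; lia))
        (@bounded_by_X m').
    rewrite (mpolyE (_ * _)) big_seq; apply: spanned_sum => m1 /hb [d1 _].
    rewrite -mul_mpolyC; apply: spannedM; first exact: invariantC.
    apply: IHD; move: hD; rewrite dm /k => hD; have := ltn_ord a; rewrite /k; lia.
- move=> _ /mapP [c _ ->]; exists (fun c' => (c == c')%:R).
  rewrite /linear_form (bigD1 c) //= eqxx scale1r big1 ?addr0 //.
  by move=> c' /negbTE; rewrite eq_sym => ->; rewrite scale0r.
- by exists (fun=> 0); rewrite /linear_form big1 // => c _; rewrite scale0r.
Qed.

Lemma spanned_all p : spanned p.
Proof.
rewrite (mpolyE p); apply: spanned_sum => m _.
rewrite -mul_mpolyC; apply: spannedM; [exact: invariantC|exact: spanned_mpolyX].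
Qed.

End Spanning.

(** * Minimal homogeneous generators *)

Section Generators.
Variables (R : numFieldType) (n d : nat).
Local Notation A := (mpoly (n * d) R).
Local Notation vp := (vperm d).

Definition alternating (p : A) :=
  forall s : 'S_n, msym (vp s) p = (-1) ^+ s *: p.

Definition alternant (p : A) : A :=
  \sum_(s : 'S_n) (-1) ^+ s *: msym (vp s) p.

Lemma alternating_alternant p : alternating (alternant p).
Proof.
move=> t; rewrite /alternant raddf_sum /= scaler_sumr.
rewrite [RHS](reindex_inj (mulIg t)) /=; apply: eq_bigr => s _.
rewrite msymZ -msymMm -vpermM odd_permM signr_addb scalerA.
by rewrite mulrC -mulrA -signr_addb addbb mulr1.
Qed.

Lemma alternantM u p : invariant u -> alternant (u * p) = u * alternant p.
Proof.
move=> hu; rewrite /alternant mulr_sumr; apply: eq_bigr => s _.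
by rewrite msymM hu scalerAr.
Qed.

Lemma alternant_sum (I : Type) (r : seq I) (F : I -> A) :
  alternant (\sum_(i <- r) F i) = \sum_(i <- r) alternant (F i).
Proof.
rewrite /alternant exchange_big; apply: eq_bigr => s _ /=.
by rewrite -scaler_sumr; congr (_ *: _); exact: raddf_sum.
Qed.

Lemma alternant_alternating p : alternating p -> alternant p = n`!%:R *: p.
Proof.
move=> hp; rewrite /alternant (eq_bigr (fun=> p)) => [|s _].
  by rewrite sumr_const card_Sn scaler_nat.
by rewrite hp scalerA -signr_addb addbb scale1r.
Qed.

Lemma homog_alternant e (p : A) : p \is ishomog1 e mdeg ->
  alternant p \is ishomog1 e mdeg.
Proof.
rewrite !homog_piE => /eqP hp; apply/eqP; rewrite /alternant raddf_sum.
by apply: eq_bigr => s _; rewrite /= linearZ /= -msym_pihomog hp.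
Qed.

Definition generates (m : nat) (f : 'I_m -> A) :=
  (forall i, alternating (f i)) /\
  forall g, alternating g -> exists u : 'I_m -> A,
    (forall i, invariant (u i)) /\ g = \sum_(i < m) u i * f i.

Definition small_homogeneous (m : nat) (f : 'I_m -> A) :=
  forall i, exists e, (e <= 'C(n, 2))%N /\ f i \is ishomog1 e mdeg.

(** Apply [alternant] to an expression of g in the small monomials: invariant coefficients pass
    through it, and g itself is multiplied by n!. *)
Lemma generates_alternants : exists m (f : 'I_m -> A),
  generates f /\ small_homogeneous f.
Proof.
pose T : finType := bmultinom (n * d) 'C(n, 2).+1.
exists #|T|, (fun i : 'I_#|T| => alternant (mpolyX R (bmnm (enum_val i)))).
split; [split=> [i|g hg]|move=> i].
- exact: alternating_alternant.
- have [u [hu gE]] := spanned_all g.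
  exists (fun i => mpolyC _ (n`!%:R^-1) * u (enum_val i)); split=> [i|].
    by apply: invariantM => //; apply: invariantC.
  have : n`!%:R *: g = \sum_(b : T) u b * alternant (mpolyX R (bmnm b)).
    rewrite -alternant_alternating // {1}gE alternant_sum.
    by apply: eq_bigr => b _; rewrite alternantM.
  move/(congr1 (fun p => n`!%:R^-1 *: p)).
  rewrite scalerA mulVf ?scale1r ?pnatr_eq0 -?lt0n ?fact_gt0 // => ->.
  rewrite scaler_sumr (reindex _ (onW_bij _ (enum_val_bij T))) /=.
  by apply: eq_bigr => i _; rewrite -mulrA mul_mpolyC.
- exists (mdeg (bmnm (enum_val i))); split; first by rewrite -ltnS; case: (enum_val i).
  by apply: homog_alternant; rewrite dhomogX.
Qed.

(** A homogeneous factor shifts the grading by its degree. Subtraction in [nat] truncates, hence the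
    case distinction: below degree e the product has no component. *)
Lemma pihomogM_homog e D (p q : A) : q \is ishomog1 e mdeg ->
  pihomog mdeg D (p * q) =
  (if (e <= D)%N then pihomog mdeg (D - e) p else 0) * q.
Proof.
move=> hq; have {1}-> := @pihomog_partitionE _ _ mdeg (maxn (msize p) D.+1) p (leq_maxl _ _).
rewrite mulr_suml raddf_sum /=.
have hM j := dhomogM (pihomogP mdeg j p) hq.
case: leqP => [eD|De]; last first.
  rewrite mul0r big1 // => j _; apply: pihomog_ne0 (hM j).
  by apply/eqP => E; move: De; rewrite -E; lia.
have lt : (D - e < maxn (msize p) D.+1)%N by rewrite leq_max; apply/orP; right; lia.
rewrite (bigD1 (Ordinal lt)) //= [X in _ + X]big1 ?addr0 => [|j ne].
  by have := hM (D - e)%N; rewrite subnK // => /pihomog_dE.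
apply: pihomog_ne0 (hM j); apply: contraNneq ne => E.
by apply/eqP/val_inj => /=; lia.
Qed.

Lemma pihomog0_mcoeff (p : A) : pihomog mdeg 0 p = mpolyC _ (mcoeff mnm0 p).
Proof.
apply/mpolyP => m; rewrite mcoeffC.
have [->|ne] := eqVneq m mnm0; last first.
  by rewrite mulr0 (dhomog_nemf_coeff (pihomogP mdeg 0 p)) // mdeg_eq0.
transitivity (mcoeff mnm0 (\sum_(e < (msize p).+1) pihomog mdeg e p)); last first.
  by rewrite -pihomog_partitionE ?mulr1.
rewrite big_ord_recl mcoeffD /= [X in _ = _ + X]raddf_sum [X in _ = _ + X]big1 ?addr0 //= => j _.
by apply: (dhomog_nemf_coeff (pihomogP mdeg _ p)); rewrite /= mdeg0.
Qed.

Lemma invariant_pihomog e (p : A) : invariant p -> invariant (pihomog mdeg e p).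
Proof. by move=> hp s; rewrite msym_pihomog hp. Qed.

Definition irredundant (m : nat) (f : 'I_m -> A) :=
  forall (k : 'I_m) (u : 'I_m -> A), (forall i, invariant (u i)) ->
    f k != \sum_(i < m | i != k) u i * f i.

(** The Nakayama step. In the degree of [f k], the coefficient of [f k] is a scalar; a wrong value
    of it would allow the relation to be solved for [f k], against irredundancy. *)
Lemma irredundant_coeff0 (m : nat) (f : 'I_m -> A) (w : 'I_m -> A) (i k : 'I_m) :
  small_homogeneous f -> irredundant f -> (forall l, invariant (w l)) ->
  f i = \sum_l w l * f l -> mcoeff mnm0 (w k) = (i == k)%:R.
Proof.
move=> hom irr hw fE; set c := mcoeff _ _.
have /boolp.choice [e he] : forall l, exists e, f l \is ishomog1 e mdeg.
  by move=> l; have [e [_ ?]] := hom l; exists e.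
(* The parts of the [w l] that contribute in degree [e k]; for l = k this is the constant
   coefficient alone. *)
pose v l := if l == k then mpolyC (n * d) c else
  if (e l <= e k)%N then pihomog mdeg (e k - e l) (w l) else 0.
have vk : v k = mpolyC _ c by rewrite /v eqxx.
have hv l : invariant (v l).
  rewrite /v; case: eqP => _; first exact: invariantC.
  by case: ifP => _; [exact: invariant_pihomog|exact: invariant0].
have vE : (e i == e k)%:R *: f i = \sum_l v l * f l.
  transitivity (pihomog mdeg (e k) (f i)).
    case: eqP => [<-|/eqP ne]; first by rewrite scale1r pihomog_dE.
    by rewrite scale0r (pihomog_ne0 _ (he i)).
  rewrite {1}fE raddf_sum; apply: eq_bigr => l _; rewrite /v /=.
  case: eqP => [->|_]; last exact: pihomogM_homog.
  by rewrite (pihomogM_homog _ _ (he k)) leqnn subnn pihomog0_mcoeff.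
have [//|ne] := eqVneq c (i == k)%:R.
(* In degree [e k] the relation reads a f_k = sum over l != k of (v_l - [l = i and e_i = e_k]) f_l,
   and a nonzero scalar a can be inverted. *)
pose a := (i == k)%:R - c.
have a0 : a != 0 by rewrite subr_eq0 eq_sym.
pose u l : A := mpolyC _ a^-1 * (v l - mpolyC _ ((l == i) && (e i == e k))%:R).
have /negP[] : f k != \sum_(l < m | l != k) u l * f l.
  apply: irr => l; apply: invariantM; first exact: invariantC.
  by apply: invariantD => //; apply: invariantN; apply: invariantC.
apply/eqP; rewrite /u.
under eq_bigr do rewrite -mulrA mul_mpolyC.
rewrite -scaler_sumr; apply: (scalerI a0); rewrite scalerA divff // scale1r.
under eq_bigr do rewrite mulrBl mul_mpolyC.
rewrite sumrB.
have -> : \sum_(l < m | l != k) v l * f l = (e i == e k)%:R *: f i - c *: f k.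
  by rewrite vE [in RHS](bigD1 k) //= vk mul_mpolyC addrAC subrr add0r.
rewrite /a scalerBl.
have [<-|nik] := eqVneq i k.
  by rewrite eqxx big1 ?subr0 // => l /negbTE ->; rewrite scale0r.
rewrite (bigD1 i) //= eqxx /= [X in _ - (_ + X)]big1 ?addr0 => [|l /andP[_ /negbTE ->]].
  by rewrite scale0r sub0r addrAC subrr add0r.
by rewrite scale0r.
Qed.

(** Write the [f i] through the [g j] and these back through the [f k]. By [irredundant_coeff0] the
    matrices of constant coefficients, of sizes K x m and m x K, have the identity as product, so K
    <= m. *)
Lemma generates_minimal (K : nat) (f : 'I_K -> A) :
  generates f -> small_homogeneous f -> irredundant f ->
  forall m (g : 'I_m -> A), generates g -> (K <= m)%N.
Proof.
move=> [altf genf] hom irr m g [altg geng].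
have /boolp.choice [a ha] := fun i => geng _ (altf i).
have /boolp.choice [b hb] := fun j => genf _ (altg j).
pose A0 := \matrix_(i < K, j < m) mcoeff mnm0 (a i j).
pose B0 := \matrix_(j < m, k < K) mcoeff mnm0 (b j k).
apply: (@mulmx1_min _ _ _ A0 B0); apply/matrixP => i k.
rewrite !mxE -(@irredundant_coeff0 _ f (fun k => \sum_j a i j * b j k) i k) //.
- rewrite raddf_sum; apply: eq_bigr => j _; rewrite !mxE /=.
  by rewrite -[RHS]/(mcoeff _ _) rmorphM.
- move=> l; apply: (big_ind (@invariant R n d)); [exact: invariant0|exact: invariantD|].
  by move=> j _; apply: invariantM; [apply: (ha i).1|apply: (hb j).1].
rewrite (ha i).2; under [RHS]eq_bigr do rewrite mulr_suml.
rewrite exchange_big; apply: eq_bigr => j _ /=.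
by rewrite {1}(hb j).2 mulr_sumr; apply: eq_bigr => l _; rewrite mulrA.
Qed.

(** A shortest family among the homogeneous generating ones of small degree is irredundant, as a
    redundant member could be dropped; [generates_minimal] then compares it with arbitrary
    generating families. *)
Lemma exists_minimal_generators : exists K (f : 'I_K -> A),
  [/\ generates f, small_homogeneous f &
      forall m (g : 'I_m -> A), generates g -> (K <= m)%N].
Proof.
pose P m := `[< exists f : 'I_m -> A, generates f /\ small_homogeneous f >].
have exP : exists m, P m.
  by have [m [f hf]] := generates_alternants; exists m; apply/asboolP; exists f.
have [K /asboolP [f [gf hf]] minK] := ex_minnP exP.
exists K, f; suff irr : irredundant f by exact: And3 gf hf (generates_minimal gf hf irr).
move=> k.
case: K f gf hf minK k => [? _ _ _ []//|K] f [altf genf] hom minK k u hu.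
apply/negP => /eqP fk; suff : P K by move/minK; rewrite ltnn.
apply/asboolP; exists (fun i => f (lift k i)); split=> [|i]; last exact: hom.
split=> [i|g /genf [w [hw gE]]]; first exact: altf.
(* Coefficients obtained by substituting the expression of [f k] through the other generators. *)
exists (fun i => w (lift k i) + w k * u (lift k i)); split=> [i|].
  by apply: invariantD => //; apply: invariantM.
rewrite gE (bigD1_ord k) //= {1}fk mulr_sumr.
have -> : \sum_(i < K.+1 | i != k) w k * (u i * f i) =
    \sum_(i < K) w k * (u (lift k i) * f (lift k i)).
  rewrite big_mkcond (bigD1_ord k) //= eqxx add0r.
  by apply: eq_bigr => i _; rewrite eq_sym neq_lift.
rewrite -big_split /=; apply: eq_bigr => i _.
by rewrite mulrDl addrC mulrA.
Qed.

End Generators.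

(** * Functions of class C^k *)

Section SmoothCalculus.
Variables (R : realType) (n d : nat).
Local Notation M := 'M[R]_(n, d).
Local Notation A := (mpoly (n * d) R).
Local Notation e_ v := (basis_vec R v : M).

Lemma Ck_continuous k (U : set M) F x : Ck k U F -> U x -> {for x, continuous F}.
Proof. by case: k => [|k] [h _]; exact: h. Qed.

Lemma open_near_eq (U : set M) (F G : M -> R) x :
  open U -> (forall y, U y -> F y = G y) -> U x -> \near x, F x = G x.
Proof.
by move=> oU FG Ux; apply: filterS (open_nbhs_nbhs (conj oU Ux)) => y /FG.
Qed.

Lemma open_eq_partial (U : set M) (F G : M -> R) v x :
  open U -> (forall y, U y -> F y = G y) -> U x -> partial v F x = partial v G x.
Proof. by move=> oU FG Ux; apply: near_eq_derive; exact: open_near_eq FG Ux. Qed.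

(** Derivatives at points of an open set see only the values on that set. This lets a partial
    derivative be replaced by a formula that is valid on [U] only. *)
Lemma Ck_ext k (U : set M) F G :
  open U -> (forall y, U y -> F y = G y) -> Ck k U F -> Ck k U G.
Proof.
move=> oU; elim: k F G => [|k IH] F G FG.
  move=> [cF _]; split=> // x Ux; have FGx := open_near_eq oU FG Ux.
  rewrite /prop_for /continuous_at -(FG x Ux); apply: cvg_trans (cF _ Ux).
  exact: (near_eq_cvg FGx).
move=> [cF dF]; split=> [x Ux|v].
  have FGx := open_near_eq oU FG Ux.
  rewrite /prop_for /continuous_at -(FG x Ux); apply: cvg_trans (cF _ Ux).
  exact: (near_eq_cvg FGx).
have [dv Cv] := dF v; split=> [x Ux|].
  by apply: near_eq_derivable (dv _ Ux); exact: open_near_eq FG Ux.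
by apply: IH Cv => y Uy; exact: open_eq_partial FG Uy.
Qed.

Lemma Ck_subset k (U V : set M) F : V `<=` U -> Ck k U F -> Ck k V F.
Proof.
move=> VU; elim: k F => [|k IH] F [cF dF].
  by split=> // x /VU; exact: cF.
split=> [x /VU|v]; first exact: cF.
by have [dv Cv] := dF v; split=> [x /VU|]; [exact: dv|exact: IH].
Qed.

Lemma Ck_setU k (U V : set M) F : Ck k U F -> Ck k V F -> Ck k (U `|` V) F.
Proof.
elim: k F => [|k IH] F [cF dF] [cF' dF']; split=> //.
- by move=> x [/cF|/cF'].
- by move=> x [/cF|/cF'].
move=> v; have [dv Cv] := dF v; have [dv' Cv'] := dF' v.
by split=> [x [/dv|/dv']|] //; exact: IH.
Qed.

Lemma CkS k (U : set M) F : Ck k.+1 U F -> Ck k U F.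
Proof.
elim: k F => [|k IH] F [cF dF]; split=> // v.
by have [dv Cv] := dF v; split=> //; exact: IH.
Qed.

Lemma Ck_leq k m (U : set M) F : (m <= k)%N -> Ck k U F -> Ck m U F.
Proof.
move=> /subnK <-; elim: (k - m)%N => // j IH; rewrite addSn => /CkS; exact: IH.
Qed.

Lemma partial_cst v (c : R) : partial v (cst c : M -> R) = cst 0.
Proof. by apply/funext => x; rewrite /partial derive_cst. Qed.

Lemma Ck_cst k (U : set M) c : Ck k U (cst c).
Proof.
elim: k c => [|k IH] c; first by split=> // x _; exact: cst_continuous.
split=> [x _|v]; first exact: cst_continuous.
by split=> [x _|]; [exact: derivable_cst|rewrite partial_cst].
Qed.

Lemma CkD k (U : set M) F G : open U -> Ck k U F -> Ck k U G -> Ck k U (F + G).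
Proof.
move=> oU; elim: k F G => [|k IH] F G [cF dF] [cG dG].
  by split=> // x Ux; apply: continuousD; [exact: cF|exact: cG].
split=> [x Ux|v]; first by apply: continuousD; [exact: cF|exact: cG].
have [dv Cv] := dF v; have [dv' Cv'] := dG v; split=> [x Ux|].
  by apply: derivableD; [exact: dv|exact: dv'].
apply: Ck_ext (IH _ _ Cv Cv') => // y Uy.
by rewrite /partial deriveD //; [exact: dv|exact: dv'].
Qed.

Lemma CkM k (U : set M) (F G : M -> R) :
  open U -> Ck k U F -> Ck k U G -> Ck k U (F * G).
Proof.
move=> oU; elim: k F G => [|k IH] F G CF CG.
  move: CF CG => [cF _] [cG _]; split=> // x Ux.
  by apply: continuousM; [exact: cF|exact: cG].
have [CF' CG'] := (CkS CF, CkS CG); move: CF CG => [cF dF] [cG dG].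
split=> [x Ux|v]; first by apply: continuousM; [exact: cF|exact: cG].
have [dv Cv] := dF v; have [dv' Cv'] := dG v; split=> [x Ux|].
  by apply: derivableM; [exact: dv|exact: dv'].
apply: Ck_ext (CkD oU (IH _ _ CF' Cv') (IH _ _ CG' Cv)) => // y Uy.
by rewrite /partial deriveM //; [exact: dv|exact: dv'].
Qed.

Lemma Ck_scale k (U : set M) (c : R) (F : M -> R) :
  open U -> Ck k U F -> Ck k U (fun x => c * F x).
Proof. by move=> oU CF; apply: CkM (Ck_cst k U c) CF. Qed.

Lemma CkN k (U : set M) (F : M -> R) : open U -> Ck k U F -> Ck k U (- F).
Proof.
move=> oU CF; have := Ck_scale (-1) oU CF; apply: Ck_ext => // y _.
by rewrite mulN1r.
Qed.

Lemma CkB k (U : set M) F G : open U -> Ck k U F -> Ck k U G -> Ck k U (F - G).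
Proof. by move=> oU CF CG; apply: CkD => //; exact: CkN. Qed.

Lemma Ck_sum k (U : set M) (I : Type) (r : seq I) (P : pred I) (F : I -> M -> R) :
  open U -> (forall i, P i -> Ck k U (F i)) ->
  Ck k U (fun x => \sum_(i <- r | P i) F i x).
Proof.
move=> oU CF; elim: r => [|i r IH].
  by apply: Ck_ext (Ck_cst k U 0) => // y _; rewrite big_nil.
case Pi: (P i); last by apply: Ck_ext IH => // y _; rewrite big_cons Pi.
by apply: Ck_ext (CkD oU (CF i Pi) IH) => // y _; rewrite big_cons Pi.
Qed.

Lemma Ck_prod k (U : set M) (I : Type) (r : seq I) (F : I -> M -> R) :
  open U -> (forall i, Ck k U (F i)) -> Ck k U (fun x => \prod_(i <- r) F i x).
Proof.
move=> oU CF; elim: r => [|i r IH].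
  by apply: Ck_ext (Ck_cst k U 1) => // y _; rewrite big_nil.
by apply: Ck_ext (CkM oU (CF i) IH) => // y _; rewrite big_cons.
Qed.

Lemma is_derive_coord (x v : M) i j :
  is_derive x v (fun y : M => y i j) (v i j).
Proof.
have cv : (fun h : R => h^-1 *: (((fun y : M => y i j) \o shift x) (h *: v) - x i j))
    @ 0^' --> v i j.
  apply: cvg_near_cst; near=> h.
  rewrite /= !mxE addrK /GRing.scale /= mulrA mulVf ?mul1r //.
  by near: h; exact: nbhs_dnbhs_neq.
by apply: DeriveDef; [apply/cvg_ex; exists (v i j)|apply: cvg_lim cv].
Unshelve. all: by end_near. Qed.

Lemma mpoly_ring_ind (P : A -> Prop) :
  (forall c, P (mpolyC _ c)) -> (forall v, P (mpolyX R (mnm1 v))) ->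
  (forall p q, P p -> P q -> P (p + q)) -> (forall p q, P p -> P q -> P (p * q)) ->
  forall p, P p.
Proof.
move=> PC PX PD PM p; rewrite (mpolyE p).
apply: (big_ind P); [by rewrite -mpolyC0|exact: PD|move=> m _].
rewrite -mul_mpolyC; apply: (PM) => //; rewrite mpolyXE_id.
apply: (big_ind P); [by rewrite -mpolyC1|exact: PM|move=> v _].
by elim: (m v) => [|k IH]; [rewrite expr0 -mpolyC1|rewrite exprS; exact: PM].
Qed.

Lemma pevalC c : peval (mpolyC (n * d) c) = cst c :> (M -> R).
Proof. by apply/funext => x; rewrite /peval mevalC. Qed.
Lemma pevalX v : peval (mpolyX R (mnm1 v)) =
  (fun x : M => x (vindex v).1 (vindex v).2).
Proof.
apply/funext => x; rewrite /peval mevalXU -{1}(mxvec_index_vindex v).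
by rewrite mxvecE.
Qed.
Lemma pevalD (p q : A) : peval (p + q) = peval p + peval q :> (M -> R).
Proof. by apply/funext => x; rewrite /peval mevalD. Qed.
Lemma pevalM (p q : A) : peval (p * q) = peval p * peval q :> (M -> R).
Proof. by apply/funext => x; rewrite /peval mevalM. Qed.

Lemma basis_vecE v i j : e_ v i j = (mxvec_index i j == v)%:R.
Proof. by rewrite -mxvecE /basis_vec vec_mxK mxE. Qed.

Lemma is_derive_peval v (p : A) (x : M) :
  is_derive x (e_ v) (peval p) (peval (mderiv v p) x).
Proof.
elim/mpoly_ring_ind: p => [c|u|p q hp hq|p q hp hq].
- by rewrite mderivC pevalC -[0]mpolyC0 pevalC; exact: is_derive_cst.
- rewrite pevalX mderivX; apply: is_derive_eq (is_derive_coord _ _ _ _) _.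
  rewrite basis_vecE mxvec_index_vindex mnm1E /peval mevalZ.
  case: eqP => [->|_]; last by rewrite mul0r.
  by rewrite mul1r (_ : mnm_sub _ _ = mnm0) ?mpolyX0 ?meval1 //;
    apply/mnmP => w; rewrite mnmBE subnn mnm0E.
- rewrite mderivD !pevalD; exact: is_deriveD.
- rewrite mderivM pevalD !pevalM; apply: is_derive_eq (is_deriveM hp hq) _.
  by rewrite [LHS]addrC; congr (_ + _); exact: mulrC.
Qed.

Lemma partial_peval v (p : A) : partial v (peval p) = peval (mderiv v p) :> (M -> R).
Proof.
apply/funext => x.
by rewrite /partial (@derive_val _ _ _ _ _ _ _ (is_derive_peval v p x)).
Qed.

Lemma continuous_peval (p : A) : continuous (peval p : M -> R).
Proof.
elim/mpoly_ring_ind: p => [c|u|p q hp hq|p q hp hq].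
- by rewrite pevalC; exact: cst_continuous.
- by rewrite pevalX; exact: coord_continuous.
- by rewrite pevalD => x; apply: continuousD; [exact: hp|exact: hq].
- by rewrite pevalM => x; apply: continuousM; [exact: hp|exact: hq].
Qed.

Lemma Ck_peval k (U : set M) (p : A) : Ck k U (peval p).
Proof.
elim: k p => [|k IH] p; first by split=> // x _; exact: continuous_peval.
split=> [x _|v]; first exact: continuous_peval.
split=> [x _|]; last by rewrite partial_peval.
by case: (is_derive_peval v p x).
Qed.

Lemma peval_at0 (p : A) : peval p (0 : M) = mcoeff mnm0 p.
Proof.
elim/mpoly_ring_ind: p => [c|u|p q hp hq|p q hp hq].
- by rewrite pevalC mcoeffC eqxx mulr1.
- by rewrite pevalX mxE mcoeffX mnm1_eq0.
- by rewrite pevalD mcoeffD -hp -hq.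
- by rewrite pevalM rmorphM /= -hp -hq.
Qed.

(* A polynomial vanishing as a function has vanishing derivatives at 0. *)
Lemma peval_eq0 (p : A) : (forall x : M, peval p x = 0) -> p = 0.
Proof.
move=> p0; apply/mpolyP => m; rewrite mcoeff0.
have : forall x : M, peval (mderivm m p) x = 0.
  rewrite mderivm_foldr; elim: (flatten _) => //= v w IH x.
  rewrite -partial_peval (_ : peval _ = cst 0) ?partial_cst //.
  exact/funext.
move/(_ 0); rewrite /peval => h.
(* The constant coefficient of the derivative of index m is m! times the coefficient of the monomial
   m. *)
have := mcoeff_mderivm m p mnm0; rewrite addm0 => hm.
move: h; rewrite -/(peval _ _) peval_at0 hm => /eqP.
rewrite mulrn_eq0 => /orP[|/eqP //].
by rewrite gtn_eqF // prodn_gt0 // => i; rewrite ffactnn fact_gt0.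
Qed.

Lemma peval_inj (p q : A) : peval p = peval q :> (M -> R) -> p = q.
Proof.
move=> pq; apply/eqP; rewrite -subr_eq0; apply/eqP/peval_eq0 => x.
by rewrite /peval mevalB -!/(peval _ x) pq subrr.
Qed.

Lemma peval_row_perm (s : 'S_n) (p : A) (x : M) :
  peval p (row_perm s x) = peval (msym (vperm d s) p) x.
Proof.
elim/mpoly_ring_ind: p => [c|u|p q hp hq|p q hp hq].
- rewrite -[mpolyC _ c]mulr1 mul_mpolyC msymZ msym1 -mul_mpolyC mulr1.
  by rewrite !pevalC.
- rewrite msymX pevalX mxE.
  transitivity (peval (mpolyX R (mnm1 (vperm d s u))) x).
    by rewrite pevalX; case/mxvec_indexP: u => i c; rewrite vpermE !vindexK.
  congr (peval (mpolyX R _) x); apply/mnmP => w; rewrite mnmE !mnm1E.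
  by rewrite -[in RHS](inj_eq (@perm_inj _ (vperm d s))) permKV.
- by rewrite msymD !pevalD; exact: (congr2 +%R hp hq).
- by rewrite msymM !pevalM; exact: (congr2 *%R hp hq).
Qed.

End SmoothCalculus.

(** * Iterated partial derivatives along words *)

Section Words.
Variables (R : realType) (n d : nat).
Local Notation M := 'M[R]_(n, d).
Local Notation e_ v := (basis_vec R v : M).
Local Notation word := (seq 'I_(n * d)).

(** Words keep the order of differentiation, so a permutation of the particles acts letter by letter
    and no symmetry of mixed derivatives is invoked. *)
Definition partial_word (w : word) (F : M -> R) : M -> R :=
  foldr (@partial R n d) F w.

Lemma partial_word_rcons w v F :
  partial_word (rcons w v) F = partial_word w (partial v F).
Proof. by rewrite /partial_word foldr_rcons. Qed.

Lemma Ck_partial_word k (U : set M) F w :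
  Ck k U F -> (size w <= k)%N -> Ck (k - size w) U (partial_word w F).
Proof.
elim/last_ind: w k F => [|w v IH] k F CF; first by rewrite subn0.
rewrite size_rcons partial_word_rcons; case: k CF => // k [_ /(_ v) [_ Cv]].
by rewrite ltnS subSS; exact: IH.
Qed.

Lemma continuous_partial_word k (U : set M) F w x :
  Ck k U F -> (size w <= k)%N -> U x -> {for x, continuous (partial_word w F)}.
Proof. by move=> CF wk; apply: Ck_continuous (Ck_partial_word CF wk). Qed.

Lemma derivable_partial_word k (U : set M) F w v x :
  Ck k U F -> (size w < k)%N -> U x -> derivable (partial_word w F) x (e_ v).
Proof.
move=> CF wk; have := Ck_partial_word CF (ltnW wk).
by rewrite -(subnSK wk) => -[_ /(_ v) [h _]]; exact: h.
Qed.

Lemma open_eq_partial_word (U : set M) F G w x : open U ->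
  (forall y, U y -> F y = G y) -> U x -> partial_word w F x = partial_word w G x.
Proof.
move=> oU FG; elim: w x => [|v w IH] x Ux /=; first exact: FG.
exact: open_eq_partial Ux.
Qed.

Lemma partial_wordD k (U : set M) F G w x : open U -> Ck k U F -> Ck k U G ->
  (size w <= k)%N -> U x ->
  partial_word w (F + G) x = partial_word w F x + partial_word w G x.
Proof.
move=> oU CF CG; elim: w x => [|v w IH] x //= wk Ux.
rewrite (@open_eq_partial _ _ _ _ _ (partial_word w F + partial_word w G) _ _ oU _ Ux).
  by rewrite /partial deriveD //; apply: derivable_partial_word wk Ux.
by move=> y Uy; rewrite IH // ltnW.
Qed.

Lemma partial_wordZ k (U : set M) c F w x : open U -> Ck k U F ->
  (size w <= k)%N -> U x ->
  partial_word w (fun y => c * F y) x = c * partial_word w F x.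
Proof.
move=> oU CF; elim: w x => [|v w IH] x //= wk Ux.
rewrite (@open_eq_partial _ _ _ _ _ (c \*o partial_word w F) _ _ oU _ Ux).
  by rewrite /partial deriveMl //; apply: derivable_partial_word wk Ux.
by move=> y Uy; rewrite IH // ltnW.
Qed.

Lemma partial_wordB k (U : set M) F G w x : open U -> Ck k U F -> Ck k U G ->
  (size w <= k)%N -> U x ->
  partial_word w (fun y => F y - G y) x = partial_word w F x - partial_word w G x.
Proof.
move=> oU CF CG wk Ux.
transitivity (partial_word w (F + (fun y => - 1 * G y)) x).
  by apply: (open_eq_partial_word _ oU) => // y _; rewrite [RHS]/GRing.add /= mulN1r.
rewrite (partial_wordD oU CF (Ck_scale _ oU CG)) //.
by rewrite (partial_wordZ _ oU CG) // mulN1r.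
Qed.

Lemma partial_word_peval w (p : mpoly (n * d) R) :
  partial_word w (peval p) = peval (foldr (fun v => mderiv v) p w).
Proof. by elim: w => //= v w ->; rewrite partial_peval. Qed.

Lemma row_perm_basis_vec (s : 'S_n) v :
  row_perm s (e_ v) = e_ ((vperm d s)^-1%g v).
Proof.
apply/matrixP => i j; rewrite mxE !basis_vecE -vpermE.
by rewrite -[in RHS](inj_eq (@perm_inj _ (vperm d s))) permKV.
Qed.

(** [row_perm s] is linear and permutes the basis vectors, so the difference quotients coincide and
    derivatives transfer without a chain rule. *)
Lemma row_perm_growth (s : 'S_n) v (F : M -> R) (x : M) :
  (fun h : R => h^-1 *: (((F \o row_perm s) \o shift x) (h *: e_ v) -
                        (F \o row_perm s) x)) =
  (fun h : R => h^-1 *: ((F \o shift (row_perm s x))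
                          (h *: e_ ((vperm d s)^-1%g v)) - F (row_perm s x))).
Proof.
apply/funext => h /=; congr (_ *: (F _ - _)).
by rewrite -row_perm_basis_vec; apply/matrixP => i j; rewrite !mxE.
Qed.

Lemma partial_row_perm (s : 'S_n) v (F : M -> R) :
  partial v (F \o row_perm s) = partial ((vperm d s)^-1%g v) F \o row_perm s.
Proof. by apply/funext => x; rewrite /partial /derive row_perm_growth. Qed.

Lemma partial_word_row_perm (s : 'S_n) w (F : M -> R) :
  partial_word w (F \o row_perm s) =
  partial_word (map ((vperm d s)^-1%g) w) F \o row_perm s.
Proof. by elim: w => //= v w ->; rewrite partial_row_perm. Qed.

Lemma row_perm_continuous (s : 'S_n) : continuous (row_perm s : M -> M).
Proof.
move=> x B /nbhs_ballP [e e0 es]; apply/nbhs_ballP; exists e => // y [_ xy].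
by apply: es; split=> // i j; rewrite !mxE; exact: xy.
Qed.

Lemma Ck_row_perm (s : 'S_n) k (U : set M) F :
  Ck k U F -> Ck k (row_perm s @^-1` U) (F \o row_perm s).
Proof.
elim: k F => [|k IH] F [cF dF].
  split=> // x Ux; apply: continuous_comp; [exact: row_perm_continuous|exact: cF].
split=> [x Ux|v].
  by apply: continuous_comp; [exact: row_perm_continuous|exact: cF].
have [dv Cv] := dF ((vperm d s)^-1%g v); split=> [x Ux|].
  by have := dv _ Ux; rewrite /derivable row_perm_growth.
by rewrite partial_row_perm; exact: IH.
Qed.

Definition multi_word (a : 'I_(n * d) -> nat) : word :=
  flatten [seq nseq (a v) v | v <- enum 'I_(n * d)].

Lemma partialsE a F : partials a F = partial_word (multi_word a) F.
Proof.
rewrite /partials /multi_word; elim: (enum _) => //= v s ->.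
rewrite /partial_word foldr_cat; elim: (a v) => //= k ->.
by [].
Qed.

Lemma size_multi_word (a : multinom (n * d)) : size (multi_word a) = mdeg a.
Proof.
rewrite mdegE size_flatten /shape -map_comp sumnE big_map big_enum /=.
by apply: eq_bigr => v _; rewrite size_nseq.
Qed.

End Words.

(** * Symmetry of polynomials and of polynomial functions *)

Section PolynomialInvariance.
Variables (R : realType) (n d : nat).
Local Notation A := (mpoly (n * d) R).

(** A real polynomial is determined by its values, so symmetry of the function lifts to the formal
    polynomial. *)
Lemma symmetric_polyP (p : A) : symmetric_poly n d p <-> invariant p.
Proof.
split=> h s.
  by apply: (@peval_inj R n d); apply/funext => x; rewrite -peval_row_perm h.
by move=> x _; rewrite peval_row_perm h.
Qed.

Lemma antisymmetric_polyP (p : A) : antisymmetric_poly n d p <-> alternating p.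
Proof.
have E (s : 'S_n) x : (-1) ^+ s * peval p x = peval ((-1) ^+ s *: p) x :> R.
  by rewrite /peval mevalZ.
split=> h s.
  by apply: (@peval_inj R n d); apply/funext => x; rewrite -peval_row_perm h // E.
by move=> x _; rewrite peval_row_perm h E.
Qed.

Lemma generates_antisymmetricP m (f : 'I_m -> A) :
  generates_antisymmetric n d f <-> generates f.
Proof.
split=> -[h1 h2]; split=> [i|g /antisymmetric_polyP /h2 [u [hu gE]]].
- by apply/antisymmetric_polyP.
- by exists u; split=> // i; apply/symmetric_polyP.
- by apply/antisymmetric_polyP.
- by exists u; split=> // i; apply/symmetric_polyP.
Qed.

End PolynomialInvariance.

(** * Bernstein polynomials *)

Section DeCasteljau.
Variables (R : realType) (n d : nat).
Local Notation M := 'M[R]_(n, d).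
Local Notation A := (mpoly (n * d) R).
Local Notation e_ v := (basis_vec R v : M).
Local Notation word := (seq 'I_(n * d)).
Local Notation crd v x := (x (vindex v).1 (vindex v).2).

(** One word per occurrence of [v], with repetitions kept, because the list indexes the terms of a
    product rule. *)
Fixpoint deletions (v : 'I_(n * d)) (W : word) : seq word :=
  if W is u :: W' then
    (if u == v then [:: W'] else [::]) ++ map (cons u) (deletions v W')
  else [::].

Fixpoint iter_deletions (w W : word) : seq word :=
  if w is v :: w' then flatten (map (deletions v) (iter_deletions w' W))
  else [:: W].

Lemma size_deletions v W : size (deletions v W) = count_mem v W.
Proof.
by elim: W => //= u W IH; rewrite size_cat size_map IH; case: eqP.
Qed.

Lemma count_deletions u v W W' : W' \in deletions v W ->
  (count_mem u W' + (v == u))%N = count_mem u W.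
Proof.
elim: W W' => //= a W IH W'; rewrite mem_cat => /orP[|/mapP [W1 /IH h ->]].
  by case: eqP => // -> ; rewrite inE => /eqP ->; rewrite addnC.
by rewrite /= -addnA h.
Qed.

Lemma count_iter_deletions u w W W' : W' \in iter_deletions w W ->
  (count_mem u W' + count_mem u w)%N = count_mem u W.
Proof.
elim: w W' => [|v w IH] W' /=; first by rewrite inE => /eqP ->; rewrite addn0.
by move=> /flatten_mapP [W1 /IH <- /(count_deletions u) <-]; rewrite addnA.
Qed.

(** At each of the [size w] deletions, the letter to delete occurs at most m times and at least m -
    [size w] times. *)
Lemma size_iter_deletions w W m : (forall u, count_mem u W = m) ->
  ((m - size w) ^ size w <= size (iter_deletions w W) <= m ^ size w)%N.
Proof.
move=> hW; elim: w => [|v w /andP [IH1 IH2]] //=.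
rewrite size_flatten /shape -map_comp sumnE big_map.
have lo W' : W' \in iter_deletions w W ->
    (m - (size w).+1 <= size (deletions v W') <= m)%N.
  move=> /(count_iter_deletions v); rewrite hW size_deletions.
  have := count_size (pred1 v) w.
  by move: (count_mem v W') (count_mem v w) (size w) => a b c *; apply/andP; split; lia.
apply/andP; split.
  apply: (@leq_trans (\sum_(i <- iter_deletions w W) (m - (size w).+1))).
    rewrite big_const_seq count_predT iter_addn_0 expnS leq_mul2l.
    apply/orP; right; apply: leq_trans IH1; case: (size w) => // s.
    by rewrite leq_exp2r //; lia.
  by rewrite big_seq [leqRHS]big_seq; apply: leq_sum => W' /lo /andP[].
apply: (@leq_trans (\sum_(i <- iter_deletions w W) m)).
  by rewrite big_seq [leqRHS]big_seq; apply: leq_sum => W' /lo /andP[].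
by rewrite big_const_seq count_predT iter_addn_0 expnS leq_mul2l IH2 orbT.
Qed.

Variables (L h : R).

Definition unit_coord (v : 'I_(n * d)) : A :=
  (2 * L)^-1 *: mpolyX R (mnm1 v) + mpolyC _ (2^-1).

(* Multivariate Bernstein polynomials, defined by the de Casteljau recursion:
   every letter v of the word W is a Bernoulli step of length h in direction v,
   taken with probability (x_v + L) / 2L. *)
Fixpoint bernstein (W : word) (f : M -> R) (z : M) : A :=
  if W is v :: W' then
    (1 - unit_coord v) * bernstein W' f z +
    unit_coord v * bernstein W' f (z + h *: e_ v)
  else mpolyC _ (f z).

Definition delta v (f : M -> R) : M -> R := fun z => f (z + h *: e_ v) - f z.
Definition delta_word (w : word) f := foldr delta f w.

Lemma bernstein_shift W f a z :
  bernstein W (fun y => f (y + a)) z = bernstein W f (z + a).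
Proof.
by elim: W z => //= v W IH z; rewrite !IH addrAC.
Qed.

Lemma bernsteinB W f g z :
  bernstein W (fun y => f y - g y) z = bernstein W f z - bernstein W g z.
Proof.
elim: W z => [|v W IH] z /=; first by rewrite mpolyCB.
by rewrite !IH; ring.
Qed.

Lemma mderiv_unit_coord u v :
  mderiv v (unit_coord u) = mpolyC _ ((2 * L)^-1 * (u == v)%:R).
Proof.
rewrite /unit_coord mderivD mderivC addr0 mderivZ mderivX mnm1E.
rewrite scalerA; case: eqP => [->|_]; last by rewrite mulr0 scale0r mpolyC0.
rewrite mulr1 (_ : mnm_sub _ _ = mnm0); last first.
  by apply/mnmP => w; rewrite mnmBE subnn mnm0E.
by rewrite mpolyX0 -mul_mpolyC mulr1.
Qed.

(** Differentiating the probability of one step in direction v replaces that step by a finite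
    difference; the product rule sums over all such steps, and 1 / 2L is the slope of
    [unit_coord v]. *)
Lemma mderiv_bernstein v W f z :
  mderiv v (bernstein W f z) =
  (2 * L)^-1 *: \sum_(W' <- deletions v W) bernstein W' (delta v f) z.
Proof.
elim: W f z => [|u W IH] f z /=; first by rewrite mderivC big_nil scaler0.
rewrite mderivD !mderivM mderivB mderiv_unit_coord -mpolyC1 mderivC mpolyC1 !IH.
rewrite big_cat big_map /= [X in _ *: (_ + X)]big_split /= -!mulr_sumr.
set S0 := \sum_(_ <- _) _; set S1 := \sum_(_ <- _) _.
rewrite -!mul_mpolyC mpolyCM.
case: eqP => [->|_]; last by rewrite mpolyC0 big_nil; ring.
by rewrite big_seq1 /delta bernsteinB bernstein_shift mpolyC1; ring.
Qed.

Lemma mderiv_word_bernstein w W f z :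
  foldr (fun v => mderiv v) (bernstein W f z) w =
  ((2 * L)^-1 ^+ size w) *:
    \sum_(W' <- iter_deletions w W) bernstein W' (delta_word w f) z.
Proof.
elim: w => [|v w IH] /=; first by rewrite expr0 scale1r big_seq1.
rewrite IH linearZ /= exprSr -scalerA; congr (_ *: _).
rewrite big_flatten big_map /= scaler_sumr raddf_sum /=.
by apply: eq_bigr => W' _; exact: mderiv_bernstein.
Qed.

Local Notation ev W f z := (peval (bernstein W f z)).
Local Notation prob v x := (peval (unit_coord v) x).

Lemma prob_E v (x : M) : prob v x = (2 * L)^-1 * crd v x + 2^-1.
Proof.
rewrite /unit_coord pevalD pevalC -mul_mpolyC pevalM pevalC pevalX.
by [].
Qed.

Lemma ev_cons v W f z x : ev (v :: W) f z x =
  (1 - prob v x) * ev W f z x + prob v x * ev W f (z + h *: e_ v) x.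
Proof.
by rewrite /peval /= mevalD !mevalM mevalB meval1.
Qed.

Lemma ev_nil f z x : ev [::] f z x = f z.
Proof. by rewrite /= pevalC. Qed.

Definition in_box (x : M) := forall v : 'I_(n * d), - L <= crd v x <= L.

Hypothesis L_gt0 : 0 < L.

Lemma prob_itv v x : in_box x -> 0 <= prob v x <= 1.
Proof.
move=> /(_ v) /andP [h1 h2]; rewrite prob_E.
have -> : (2 * L)^-1 * crd v x + 2^-1 = (crd v x + L) / (2 * L).
  by field; rewrite gt_eqF.
rewrite divr_ge0 ?mulr_ge0 ?(ltW L_gt0) //; last by lra.
by rewrite ler_pdivrMr ?mulr_gt0 // mul1r; lra.
Qed.

(** In the box, all step probabilities lie in [0, 1], so evaluation is an average and hence monotone
    in the function. *)
Lemma ev_le W f g z x : in_box x -> (forall y, f y <= g y) ->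
  ev W f z x <= ev W g z x.
Proof.
move=> bx fg; elim: W z => [|v W IH] z; first by rewrite !ev_nil.
rewrite !ev_cons; have /andP [p0 p1] := prob_itv v bx.
by apply: lerD; apply: ler_wpM2l => //; rewrite subr_ge0.
Qed.

Lemma ev_cst W c z x : ev W (fun=> c) z x = c.
Proof.
elim: W z => [|v W IH] z; first by rewrite ev_nil.
by rewrite ev_cons !IH; ring.
Qed.

Lemma evD W f g z x : ev W (fun y => f y + g y) z x = ev W f z x + ev W g z x.
Proof.
elim: W z => [|v W IH] z; first by rewrite !ev_nil.
by rewrite !ev_cons !IH; ring.
Qed.

Lemma evZ W c f z x : ev W (fun y => c * f y) z x = c * ev W f z x.
Proof.
elim: W z => [|v W IH] z; first by rewrite !ev_nil.
by rewrite !ev_cons !IH; ring.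
Qed.

Lemma ev_sum W (I : Type) (r : seq I) (F : I -> M -> R) z x :
  ev W (fun y => \sum_(i <- r) F i y) z x = \sum_(i <- r) ev W (F i) z x.
Proof.
elim: r => [|i r IH].
  rewrite big_nil -[RHS](ev_cst W 0 z x); congr (ev W _ z x).
  by apply/funext => y; rewrite big_nil.
rewrite big_cons -IH -evD; congr (ev W _ z x).
by apply/funext => y; rewrite big_cons.
Qed.

Lemma ev_norm W f g z x : in_box x -> (forall y, `|f y| <= g y) ->
  `|ev W f z x| <= ev W g z x.
Proof.
move=> bx fg; rewrite ler_norml; apply/andP; split.
  have := @ev_le W (fun y => -1 * g y) f z x bx.
  rewrite evZ mulN1r; apply => y; rewrite mulN1r.
  by have := fg y; rewrite ler_norml => /andP[].
by apply: ev_le => // y; have := fg y; rewrite ler_norml => /andP[].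
Qed.

(** The v-coordinate of the endpoint is that of z plus h times a binomial variable, as only the
    letters v move it. The right side is squared bias plus variance. *)
Lemma ev_second_moment W v a z x :
  ev W (fun y => (crd v y - a) ^+ 2) z x =
  (crd v z + (count_mem v W)%:R * h * prob v x - a) ^+ 2 +
  (count_mem v W)%:R * h ^+ 2 * (prob v x * (1 - prob v x)).
Proof.
elim: W z => [|u W IH] z; first by rewrite ev_nil /= !mul0r !addr0.
rewrite ev_cons !IH -[count_mem v (u :: W)]/((u == v) + count_mem v W)%N natrD.
have -> : crd v (z + h *: e_ u) = crd v z + h * (u == v)%:R.
  by rewrite mxE [X in _ + X]mxE basis_vecE mxvec_index_vindex eq_sym.
by case: eqP => [->|_]; rewrite ?mulr1n ?mulr0n; ring.
Qed.

End DeCasteljau.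

(** * Mean value theorem for iterated differences *)

Section MeanValue.
Variables (R : realType) (n d : nat).
Local Notation M := 'M[R]_(n, d).
Local Notation e_ v := (basis_vec R v : M).
Local Notation word := (seq 'I_(n * d)).

Lemma derivable_translate (F : M -> R) a x v :
  derivable F (x + a) v -> derivable (fun y => F (y + a)) x v.
Proof.
rewrite /derivable; set f := (fun h => _); set g := (fun h => _).
suff -> : f = g by [].
by apply/funext => t; rewrite /f /g /= addrA.
Qed.

Lemma derive_translate (F : M -> R) a x v :
  'D_v (fun y => F (y + a)) x = 'D_v F (x + a).
Proof.
rewrite /derive; set f := (fun h => _); set g := (fun h => _).
suff -> : f = g by [].
by apply/funext => t; rewrite /f /g /= addrA.
Qed.

Lemma is_derive_line (F : M -> R) z v (t : R) : derivable F (z + t *: v) v ->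
  is_derive t 1 (fun s : R => F (z + s *: v)) ('D_v F (z + t *: v)).
Proof.
move=> dF; have E : (fun h : R => h^-1 *: (((fun s : R => F (z + s *: v)) \o shift t) (h *: 1) -
     F (z + t *: v))) =
  (fun h : R => h^-1 *: ((F \o shift (z + t *: v)) (h *: v) - F (z + t *: v))).
  apply/funext => h /=; congr (_ *: (F _ - _)).
  by rewrite [h *: 1]mulr1 scalerDl addrCA.
by apply: DeriveDef; rewrite /derivable /derive E.
Qed.

Lemma delta_mean_value (h : R) v (F : M -> R) z : 0 <= h ->
  (forall x, derivable F x (e_ v)) ->
  exists2 t, 0 <= t <= h & delta h v F z = h * partial v F (z + t *: e_ v).
Proof.
move=> h0 dF; pose f (s : R) := F (z + s *: e_ v).
have df (t : R) : is_derive t 1 f ('D_(e_ v) F (z + t *: e_ v)).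
  exact: is_derive_line.
have cf : {within `[0, h], continuous f}.
  apply: continuous_subspaceT => t; apply: differentiable_continuous.
  by apply/derivable1_diffP; exact: (@ex_derive _ _ _ _ _ _ _ (df t)).
have [t] := MVT_segment h0 (fun t _ => df t) cf.
rewrite in_itv /= => th E; exists t => //.
by move: E; rewrite /f scale0r addr0 subr0 mulrC.
Qed.

Lemma deltaC h u v (F : M -> R) : delta h u (delta h v F) = delta h v (delta h u F).
Proof.
apply/funext => z; rewrite /delta (addrAC z) !opprB addrACA [RHS]addrACA.
by congr (_ + _); exact: addrC.
Qed.

Lemma delta_wordC h w v (F : M -> R) :
  delta_word h w (delta h v F) = delta h v (delta_word h w F).
Proof. by elim: w => //= u w ->; rewrite deltaC. Qed.

Lemma derivable_delta h u v (F : M -> R) :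
  (forall x, derivable F x (e_ v)) -> forall x, derivable (delta h u F) x (e_ v).
Proof.
move=> dF x; apply: derivableB => //.
by apply: derivable_translate.
Qed.

Lemma partial_delta h u v (F : M -> R) : (forall x, derivable F x (e_ v)) ->
  partial v (delta h u F) = delta h u (partial v F).
Proof.
move=> dF; apply/funext => x; rewrite /partial /delta deriveB.
- by rewrite derive_translate.
- exact: derivable_translate.
- exact: dF.
Qed.

Lemma derivable_delta_word h w v (F : M -> R) :
  (forall x, derivable F x (e_ v)) ->
  forall x, derivable (delta_word h w F) x (e_ v).
Proof.
move=> dF; elim: w => [|u w IH] x; [exact: dF|exact: derivable_delta].
Qed.

Lemma partial_delta_word h w v (F : M -> R) : (forall x, derivable F x (e_ v)) ->
  partial v (delta_word h w F) = delta_word h w (partial v F).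
Proof.
move=> dF; elim: w => //= u w <-; apply: partial_delta.
exact: derivable_delta_word.
Qed.

Lemma norm_basis_vec v : `|e_ v| <= 1.
Proof.
rewrite -[`|_|]/(mx_norm _) mx_normrE; apply/bigmax_leP; split=> //= -[i j] _ /=.
by rewrite basis_vecE; case: eqP; rewrite ?normr1 ?normr0.
Qed.

(** Differences commute with each other and with partial derivatives. Each letter can thus be
    exchanged for h times a derivative, at a point moved by at most h; the last letter goes first
    because [Ck] speaks of the derivatives of [F] itself. *)
Lemma delta_word_mean_value (h : R) k w (F : M -> R) z : 0 <= h ->
  Ck k setT F -> (size w <= k)%N ->
  exists2 xi, `|xi - z| <= (size w)%:R * h &
    delta_word h w F z = h ^+ size w * partial_word w F xi.
Proof.
move=> h0; elim/last_ind: w k F z => [|w v IH] k F z CF wk.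
  by exists z; rewrite ?subrr ?normr0 ?mul0r // expr0 mul1r.
rewrite size_rcons in wk *; case: k CF wk => // k [_ /(_ v) [dF CF]] wk.
have {}dF x : derivable F x (e_ v) by exact: dF.
have [t /andP [t0 th] E] := delta_mean_value z h0 (@derivable_delta_word h w v F dF).
have [xi xiz E'] := IH k _ (z + t *: e_ v) CF wk.
exists xi.
  rewrite -[xi - z](subrKA (z + t *: e_ v)) -natr1 mulrDl mul1r.
  apply: le_trans (ler_normD _ _) _; apply: lerD => //.
  rewrite addrAC subrr add0r normrZ ger0_norm //.
  by apply: le_trans th; rewrite ler_piMr // norm_basis_vec.
rewrite /delta_word foldr_rcons -/(delta_word h w _) delta_wordC E.
by rewrite partial_delta_word // E' partial_word_rcons exprS mulrA.
Qed.

End MeanValue.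

(** * Convergence of Bernstein polynomials with derivatives *)

Section BernsteinConvergence.
Variables (R : realType) (n d : nat).
Local Notation M := 'M[R]_(n, d).
Local Notation e_ v := (basis_vec R v : M).
Local Notation word := (seq 'I_(n * d)).
Local Notation crd v x := (x (vindex v).1 (vindex v).2).

(** A form of uniform continuity that can be averaged against a random endpoint knowing only its
    second moments. *)
Definition quadratic_modulus (G : M -> R) := forall eps, 0 < eps ->
  exists2 C, 0 <= C & forall x y, `|G y - G x| <= eps + C * `|y - x| ^+ 2.

Lemma sqr_norm_le (x : M) : `|x| ^+ 2 <= \sum_v (crd v x) ^+ 2.
Proof.
have [->|x0] := eqVneq x 0.
  by rewrite normr0 expr0n /= sumr_ge0 // => v _; exact: sqr_ge0.
have nx : mx_norm x != 0 by rewrite -[mx_norm x]/(`|x|) normr_eq0.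
have [[i j] /= E] := mx_norm_neq0 nx.
rewrite -[`|x|]/(mx_norm x) E (bigD1 (mxvec_index i j)) //= vindexK /=.
rewrite -normrX ger0_norm ?sqr_ge0 // lerDl sumr_ge0 // => v _; exact: sqr_ge0.
Qed.

(** There are m steps in every direction; with h = 2L / m they lead from the corner -L of the box to
    the corner L. *)
Definition full_word (m : nat) : word := flatten (nseq m (enum 'I_(n * d))).

Lemma count_full_word m v : count_mem v (full_word m) = m.
Proof.
elim: m => //= m IH; rewrite /full_word /= count_cat -/(full_word m) IH.
by rewrite count_uniq_mem ?enum_uniq // mem_enum.
Qed.

Lemma bernoulli_ineq (x : R) j : 0 <= x <= 1 -> 1 - j%:R * x <= (1 - x) ^+ j.
Proof.
move=> /andP [x0 x1]; elim: j => [|j IH]; first by rewrite mul0r subr0 expr0.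
rewrite exprS -natr1; have h : 0 <= 1 - x by lra.
apply: le_trans (ler_wpM2l h IH).
have := mulr_ge0 (ler0n R j) (mulr_ge0 x0 x0); lra.
Qed.

(** The derivative along w is m^-j times a sum, over the deletions of w, of averages of difference
    quotients. Each average is close to the derivative of F at x, with a second moment error of
    order 1 / m, and the number of terms is m^j up to a relative error of order 1 / m. *)
Lemma bernstein_estimate (L : R) (m k : nat) (w : word) (F : M -> R) (B eps C : R)
    (x : M) :
  0 < L -> (0 < m)%N -> (size w <= k)%N -> (k <= m)%N -> Ck k setT F ->
  `|partial_word w F x| <= B -> 0 <= C -> 0 <= eps ->
  (forall y, `|partial_word w F y - partial_word w F x| <=
     eps + C * `|y - x| ^+ 2) ->
  in_box L x ->
  `|partial_word w (peval (bernstein L (2 * L / m%:R) (full_word m) F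
        (const_mx (- L)))) x - partial_word w F x| <=
  eps + (2 * C * (k%:R ^+ 2 * (2 * L) ^+ 2 +
     (n * d)%:R * (k%:R ^+ 2 * (2 * L) ^+ 2 + (2 * L) ^+ 2)) + k%:R ^+ 2 * B) / m%:R.
Proof.
move=> L0 m0 wk km CF HB C0 eps0 HG bx.
set h := 2 * L / m%:R; set z0 := const_mx (- L).
set G := partial_word w F; set j := size w.
have mp : 0 < m%:R :> R by rewrite ltr0n.
have h0 : 0 < h by rewrite divr_gt0 // mulr_gt0.
have jk : j%:R <= k%:R :> R by rewrite ler_nat.
have hm : m%:R * h = 2 * L by rewrite /h mulrC divfK // gt_eqF.
(* The difference quotient of order j, equal to G at a point within j h of y. *)
pose Q (y : M) := h ^- j * delta_word h w F y.
(* The bound combines the displacement of the mean value point with, for each of the n d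
   coordinates, squared bias and variance of the endpoint. *)
pose E := 2 * C * (k%:R ^+ 2 * h ^+ 2 +
   (n * d)%:R * (k%:R ^+ 2 * h ^+ 2 + m%:R * h ^+ 2)).
pose c0 := eps + 2 * C * (k%:R ^+ 2 * h ^+ 2).
pose q (y : M) := \sum_(v <- enum 'I_(n * d)) (crd v y - crd v x) ^+ 2.
have QG y : `|Q y - G x| <= c0 + 2 * C * q y.
  have [xi xiy dE] := delta_word_mean_value y (ltW h0) CF wk.
  rewrite /Q dE mulKf; last by rewrite expf_neq0 // gt_eqF.
  apply: le_trans (HG xi) _; rewrite /c0 -addrA lerD2l.
  have E1 : `|xi - x| <= k%:R * h + `|y - x|.
    rewrite -[xi - x](subrKA y); apply: le_trans (ler_normD _ _) _.
    rewrite lerD2r; apply: le_trans xiy _.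
    by rewrite ler_wpM2r // ltW.
  have E2 : `|y - x| ^+ 2 <= q y.
    apply: le_trans (sqr_norm_le _) _; rewrite /q big_enum /=.
    by apply: ler_sum => v _; rewrite !mxE.
  have E3 : `|xi - x| ^+ 2 <= 2 * (k%:R ^+ 2 * h ^+ 2) + 2 * `|y - x| ^+ 2.
    have n1 := normr_ge0 (xi - x); have n2 := normr_ge0 (y - x).
    have kh : 0 <= k%:R * h by rewrite mulr_ge0 // ltW.
    apply: (@le_trans _ _ ((k%:R * h + `|y - x|) ^+ 2)).
      by rewrite ler_pXn2r // nnegrE // addr_ge0.
    rewrite -exprMn; have := sqr_ge0 (k%:R * h - `|y - x|).
    by rewrite sqrrB sqrrD; lra.
  rewrite -!mulrA -!(mulrCA C) -mulrDr ler_wpM2l //; lra.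
have evQ W' : W' \in iter_deletions w (full_word m) ->
    `|peval (bernstein L h W' Q z0) x - G x| <= eps + E.
  move=> hW'; rewrite -{1}(ev_cst L h W' (G x) z0 x).
  have -> : peval (bernstein L h W' Q z0) x - peval (bernstein L h W' (fun=> G x) z0) x
      = peval (bernstein L h W' (fun y => Q y - G x) z0) x.
    by rewrite bernsteinB /peval mevalB.
  apply: le_trans (@ev_norm _ _ _ L h L0 W' _ (fun y => c0 + 2 * C * q y) z0 x bx QG) _.
  rewrite evD ev_cst evZ /q ev_sum /c0 -addrA lerD2l /E mulrDr lerD2l.
  apply: ler_wpM2l; first by rewrite mulr_ge0.
  rewrite big_enum /= -[(n * d)%N in leRHS](card_ord (n * d)) -sum1_card natr_sum mulr_suml.
  apply: ler_sum => v _; rewrite mul1r ev_second_moment.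
  have cE := count_iter_deletions v hW'; rewrite count_full_word in cE.
  have /andP [p0 p1] := prob_itv L0 v bx.
  set p := peval (unit_coord L v) x in p0 p1 *.
  set a := count_mem v w in cE; set c := count_mem v W' in cE *.
  have aj : a%:R <= k%:R :> R.
    by rewrite ler_nat; apply: leq_trans wk; exact: count_size.
  have cm : c%:R = m%:R - a%:R :> R by rewrite -cE natrD addrK.
  have xE : crd v x = 2 * L * p - L.
    by rewrite /p prob_E; field; rewrite gt_eqF.
  (* With all m steps the mean endpoint would be x itself; the a deleted ones displace it by - a h
     p. *)
  rewrite mxE; have -> : - L + c%:R * h * p - crd v x = - (a%:R * h * p).
    by rewrite xE cm -hm; ring.
  apply: lerD.
    rewrite sqrrN exprMn exprMn -mulrA.
    have t1 : a%:R ^+ 2 <= k%:R ^+ 2 :> R by rewrite ler_pXn2r // nnegrE.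
    have t2 : h ^+ 2 * p ^+ 2 <= h ^+ 2 by rewrite ler_piMr ?sqr_ge0 // expr_le1.
    by apply: ler_pM => //; rewrite -?exprMn sqr_ge0.
  have hh := sqr_ge0 h.
  have t1 : c%:R * h ^+ 2 <= m%:R * h ^+ 2 by rewrite ler_wpM2r // cm lerBlDr lerDl.
  have t2 : p * (1 - p) <= 1 by nra.
  have t3 : 0 <= p * (1 - p) by rewrite mulr_ge0 // subr_ge0.
  by rewrite -[leRHS]mulr1; apply: ler_pM => //; rewrite mulr_ge0.
rewrite partial_word_peval mderiv_word_bernstein -/h.
set S := iter_deletions w (full_word m).
(* As h = 2L / m, normalizing the differences turns (2L)^-j into m^-j. *)
have -> : peval ((2 * L)^-1 ^+ j *: (\sum_(W' <- S) bernstein L h W' (delta_word h w F) z0)) x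
  = m%:R ^- j * \sum_(W' <- S) peval (bernstein L h W' Q z0) x.
  rewrite /peval mevalZ raddf_sum /= !mulr_sumr; apply: eq_bigr => W' _.
  by rewrite -!/(peval _ x) /Q evZ -hm [in LHS]exprVn exprMn invfM mulrA.
have /andP [S1 S2] := size_iter_deletions w (count_full_word m).
rewrite -/S -/j in S1 S2.
have Sm : (size S)%:R * m%:R ^- j <= 1 :> R.
  by rewrite ler_pdivrMr ?exprn_gt0 // mul1r -natrX ler_nat.
(* There are at least (m - j)^j deletions, and (1 - j/m)^j >= 1 - j^2/m by the Bernoulli
   inequality. *)
have Sm' : 1 - k%:R ^+ 2 / m%:R <= (size S)%:R * m%:R ^- j :> R.
  have jm : (j <= m)%N by apply: leq_trans km.
  apply: (@le_trans _ _ ((1 - j%:R / m%:R) ^+ j)).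
    apply: le_trans (bernoulli_ineq _ _); last first.
      by rewrite divr_ge0 //= ler_pdivrMr // mul1r ler_nat.
    rewrite lerD2l lerN2 mulrA ler_pM2r ?invr_gt0 // expr2.
    by rewrite ler_pM.
  have -> : 1 - j%:R / m%:R = (m - j)%:R / m%:R :> R.
    by rewrite natrB // mulrBl divff // gt_eqF.
  rewrite exprMn exprVn ler_pM2r ?invr_gt0 ?exprn_gt0 //.
  by rewrite -natrX ler_nat.
(* The total weight is at most 1: the error splits into an average deviation and the missing weight
   times G x, which [B] controls. *)
have -> : m%:R ^- j * \sum_(W' <- S) peval (bernstein L h W' Q z0) x - G x =
  m%:R ^- j * \sum_(W' <- S) (peval (bernstein L h W' Q z0) x - G x) +
  ((size S)%:R * m%:R ^- j - 1) * G x.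
  rewrite sumrB big_const_seq count_predT iter_addr_0 -mulr_natl; ring.
apply: le_trans (ler_normD _ _) _.
have T1 : `|m%:R ^- j * \sum_(W' <- S) (peval (bernstein L h W' Q z0) x - G x)| <= eps + E.
  have EE : 0 <= eps + E.
    by rewrite addr_ge0 // !(mulr_ge0, addr_ge0) // ?exprn_ge0 // ltW.
  rewrite normrM ger0_norm ?invr_ge0 ?exprn_ge0 //.
  apply: (@le_trans _ _ (m%:R ^- j * ((size S)%:R * (eps + E)))).
    rewrite ler_wpM2l ?invr_ge0 ?exprn_ge0 //.
    apply: le_trans (ler_norm_sum _ _ _) _.
    rewrite mulr_natl -iter_addr_0 -count_predT -big_const_seq.
    by rewrite big_seq [leRHS]big_seq; apply: ler_sum => W' /evQ.
  by rewrite mulrA ler_piMl // mulrC.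
have T2 : `|((size S)%:R * m%:R ^- j - 1) * G x| <= k%:R ^+ 2 / m%:R * B.
  rewrite normrM; apply: ler_pM => //; rewrite ler0_norm ?subr_le0 //.
  by rewrite opprB lerBlDr addrC -lerBlDr.
apply: le_trans (lerD T1 T2) _.
rewrite -addrA lerD2l mulrDl; apply: lerD; last by rewrite mulrAC.
rewrite /E -[leRHS]mulrA.
set X := (2 * L) ^+ 2.
have hX : h ^+ 2 <= X / m%:R.
  rewrite /h exprMn ler_wpM2l ?sqr_ge0 // expr2 ler_piMl ?invr_ge0 //.
  by rewrite invf_le1 // ler1n.
have mhX : m%:R * h ^+ 2 = X / m%:R.
  by rewrite expr2 mulrA hm /h /X expr2 mulrA.
have -> : (k%:R ^+ 2 * X + (n * d)%:R * (k%:R ^+ 2 * X + X)) / m%:R =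
    k%:R ^+ 2 * (X / m%:R) + (n * d)%:R * (k%:R ^+ 2 * (X / m%:R) + X / m%:R).
  by ring.
rewrite mhX ler_wpM2l ?mulr_ge0 // lerD // ler_wpM2l ?sqr_ge0 //.
by rewrite lerD // ler_wpM2l ?sqr_ge0.
Qed.

End BernsteinConvergence.

(** * Approximation on compact sets *)

Section CompactSupport.
Variables (R : realType) (n d : nat).
Local Notation M := 'M[R]_(n, d).
Local Notation A := (mpoly (n * d) R).
Local Notation word := (seq 'I_(n * d)).
Local Notation crd v x := (x (vindex v).1 (vindex v).2).

Lemma norm_leP (x : M) (r : R) : 0 <= r ->
  reflect (forall i j, `|x i j| <= r) (`|x| <= r).
Proof.
move=> r0; rewrite -[`|x|]/(mx_norm x) mx_normrE; apply: (iffP idP).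
  by move=> /bigmax_leP [_ h] i j; exact: (h (i, j)).
by move=> h; apply/bigmax_leP; split=> // -[i j] _; exact: h.
Qed.

Lemma norm_crd (x : M) i j : `|x i j| <= `|x|.
Proof. exact/norm_leP. Qed.

(** For r >= 0 the ball of the maximum norm is the image of a product of segments under the
    continuous reshaping [vec_mx]. *)
Lemma compact_norm_ball (r : R) : compact [set x : M | `|x| <= r].
Proof.
have [r0|r0] := leP 0 r; last first.
  have -> : [set x : M | `|x| <= r] = set0; last exact: compact0.
  rewrite -subset0 => x /= xr.
  by have := le_lt_trans xr r0; rewrite normr_lt0.
have K := @rV_compact R (n * d) (fun=> `[- r, r]%classic) (fun=> @segment_compact _ _ _).
have cvec : continuous (@vec_mx R n d : 'rV[R]_(n * d) -> M).
  move=> x B /nbhs_ballP [e e0 es]; apply/nbhs_ballP; exists e => // y [_ xy].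
  by apply: es; split=> // i j; rewrite !mxE; exact: xy.
have := continuous_compact (continuous_subspaceT cvec) K.
rewrite (_ : _ @` _ = [set x : M | `|x| <= r]) //; apply/seteqP; split=> x /=.
  move=> [y yr <-]; apply/norm_leP => // i j; rewrite mxE.
  by have := yr (mxvec_index i j); rewrite in_itv /= ler_norml.
move=> /(norm_leP _ r0) xr; exists (mxvec x); last exact: mxvecK.
move=> v; case/mxvec_indexP: v => i j; rewrite mxvecE in_itv /= -ler_norml.
exact: xr.
Qed.

Definition vanishes_outside (r : R) (G : M -> R) := forall x, r < `|x| -> G x = 0.

Lemma open_norm_gt (r : R) : open [set x : M | r < `|x|].
Proof.
have := @open_comp _ _ (fun x : M => `|x|) [set y : R | r < y].
by apply; [move=> x _; apply: norm_continuous|exact: open_gt].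
Qed.

Lemma vanishes_outside_partial_word r (F : M -> R) w :
  vanishes_outside r F -> vanishes_outside r (partial_word w F).
Proof.
move=> F0 x xr.
rewrite (@open_eq_partial_word _ _ _ _ F (cst 0) w x (@open_norm_gt r)) //.
suff -> : partial_word w (cst 0 : M -> R) = cst 0 by [].
by elim: w => //= v w ->; rewrite partial_cst.
Qed.

Lemma bounded_of_compact_support r (G : M -> R) :
  continuous G -> vanishes_outside r G -> exists2 B, 0 <= B & forall x, `|G x| <= B.
Proof.
move=> cG G0.
have cK := continuous_compact (continuous_subspaceT cG) (@compact_norm_ball r).
have [B [_ HB]] := compact_bounded cK.
exists (`|B| + 1); first by rewrite addr_ge0.
move=> x; have [xr|xr] := leP `|x| r; last by rewrite (G0 _ xr) normr0 addr_ge0.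
by apply: (HB (`|B| + 1)); [rewrite ltr_pwDr // ler_norm|exists x].
Qed.

Lemma uniformly_continuous_of_compact_support r (G : M -> R) :
  continuous G -> vanishes_outside r G -> forall eps, 0 < eps ->
  exists2 delta, 0 < delta & forall x y, `|y - x| < delta -> `|G y - G x| < eps.
Proof.
move=> cG G0 eps e0.
have /compact_near_coveringP cK := @compact_norm_ball (r + 1).
have e2 : 0 < eps / 2 by rewrite divr_gt0.
have : \forall dl \near (0 : R)^'+,
    [set x : M | `|x| <= r + 1] `<=`
    (fun x => forall y, `|y - x| < dl -> `|G y - G x| < eps).
  apply: cK => x _.
  have /cvgrPdist_lt /(_ _ e2) /nbhs_ballP [t /= t0 Ht] := cG x.
  exists (ball x (t / 2), [set s | s < t / 2]).
    split; first by apply: nbhsx_ballx; rewrite divr_gt0.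
    by apply: nbhs_right_lt; rewrite divr_gt0.
  move=> [x' s] /= [xx' st] y yx'.
  have h1 : `|G x - G x'| < eps / 2.
    by apply: Ht; apply: le_ball xx'; rewrite ler_pdivrMr // ler_pMr // ler1n.
  have h2 : `|G x - G y| < eps / 2.
    apply: Ht; rewrite [t]splitr; apply: ball_triangle xx' _.
    by rewrite -ball_normE /= distrC (lt_trans yx').
  rewrite -(subrKA (G x)) (splitr eps); apply: le_lt_trans (ler_normD _ _) _.
  by rewrite ltrD // distrC.
(* With dl < 1, a point within dl of one outside radius r + 1 is still outside radius r, so G
   vanishes at both. *)
move=> H; have [dl [dl0 dl1 Hdl]] : exists dl : R, [/\ 0 < dl, dl < 1 &
    [set x : M | `|x| <= r + 1] `<=`
    (fun x => forall y, `|y - x| < dl -> `|G y - G x| < eps)].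
  have : \forall dl \near (0 : R)^'+, [/\ 0 < dl, dl < 1 &
    [set x : M | `|x| <= r + 1] `<=`
    (fun x => forall y, `|y - x| < dl -> `|G y - G x| < eps)].
    near=> dl; split; near: dl => //; first exact: nbhs_right_gt.
    exact: nbhs_right_lt.
  by move/filter_ex.
exists dl => // x y xy; have [xr|xr] := leP `|x| (r + 1); first exact: (Hdl x).
rewrite (G0 x) ?(G0 y) ?subr0 ?normr0 //; last by rewrite (lt_trans _ xr) // ltrDl.
have : `|x| <= `|y| + `|y - x|.
  by have := ler_normB y (y - x); rewrite subKr.
lra.
Unshelve. all: by end_near. Qed.

(** Close points are handled by uniform continuity; for points at distance at least dl, the bound 2B
    is at most 2B |y - x|^2 / dl^2. *)
Lemma quadratic_modulus_of_compact_support r (G : M -> R) :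
  continuous G -> vanishes_outside r G -> quadratic_modulus G.
Proof.
move=> cG G0 eps e0.
have [B B0 HB] := bounded_of_compact_support cG G0.
have [dl dl0 Hdl] := uniformly_continuous_of_compact_support cG G0 e0.
exists (2 * B / dl ^+ 2); first by rewrite divr_ge0 ?mulr_ge0 ?exprn_ge0 // ltW.
move=> x y; have [xy|xy] := ltP `|y - x| dl.
  apply: le_trans (ltW (Hdl _ _ xy)) _; rewrite lerDl.
  by rewrite !(mulr_ge0, invr_ge0, exprn_ge0) // ltW.
apply: (@le_trans _ _ (2 * B)).
  by apply: le_trans (ler_normB _ _) _; rewrite mulr2n mulrDl mul1r lerD.
apply: (@le_trans _ _ (2 * B / dl ^+ 2 * `|y - x| ^+ 2)); last by rewrite lerDr ltW.
rewrite -mulrA ler_peMr ?mulr_ge0 // mulrC ler_pdivlMr ?exprn_gt0 // mul1r.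
by rewrite ler_pXn2r // nnegrE // ltW.
Qed.

Lemma weierstrass_compact_support k r (F : M -> R) (L eps : R) :
  Ck k setT F -> vanishes_outside r F -> 0 < L -> 0 < eps ->
  exists p : A, forall w, (size w <= k)%N -> forall x : M, `|x| <= L ->
    `|partial_word w F x - partial_word w (peval p) x| < eps.
Proof.
move=> CF F0 L0 e0.
have e2 : 0 < eps / 2 by rewrite divr_gt0.
have ex_m0 (w : word) : exists m0 : nat, (size w <= k)%N ->
    forall m, (m0 <= m)%N -> (k <= m)%N -> (0 < m)%N -> forall x : M, `|x| <= L ->
    `|partial_word w (peval (bernstein L (2 * L / m%:R) (full_word n d m) F
        (const_mx (- L)))) x - partial_word w F x| < eps.
  have [wk|wk] := leqP (size w) k; last by exists 0%N.
  have cG : continuous (partial_word w F).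
    by move=> x; exact: (continuous_partial_word CF wk).
  have G0 := vanishes_outside_partial_word w F0.
  have [B B0 HB] := bounded_of_compact_support cG G0.
  have [C C0 HC] := quadratic_modulus_of_compact_support cG G0 e2.
  set K := (2 * C * (k%:R ^+ 2 * (2 * L) ^+ 2 +
     (n * d)%:R * (k%:R ^+ 2 * (2 * L) ^+ 2 + (2 * L) ^+ 2)) + k%:R ^+ 2 * B).
  have K0 : 0 <= K.
    by rewrite !(addr_ge0, mulr_ge0, exprn_ge0) // ltW.
  have KE0 : 0 <= K / (eps / 2) by rewrite divr_ge0 // ltW.
  exists (Num.bound (K / (eps / 2))) => _ m mK km m0 x xL.
  have bx : in_box L x by move=> v; rewrite -ler_norml (le_trans (norm_crd _ _ _)).
  apply: le_lt_trans (bernstein_estimate L0 m0 wk km CF (HB x) C0 (ltW e2) (HC x) bx) _.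
  rewrite -/K [ltRHS]splitr ltrD2l ltr_pdivrMr ?ltr0n // mulrC -ltr_pdivrMr //.
  apply: lt_le_trans (archi_boundP KE0) _.
  by rewrite ler_nat.
have /boolp.choice [m0 Hm0] := ex_m0.
(* Only finitely many words have length at most k, so a single m serves all the derivatives; adding
   k and 1 gives k <= m and 0 < m. *)
pose m := ((\max_(j < k.+1) \max_(t : j.-tuple 'I_(n * d)) m0 t) + k).+1.
exists (bernstein L (2 * L / m%:R) (full_word n d m) F (const_mx (- L))).
move=> w wk x xL; rewrite distrC; apply: Hm0 => //; last by rewrite /m; lia.
rewrite /m -addnS; apply: leq_trans (leq_addr _ _).
have wk' : (size w < k.+1)%N by [].
apply: leq_trans (leq_bigmax (Ordinal wk')).
exact: (@leq_bigmax _ (fun t : (size w).-tuple 'I_(n * d) => m0 t) (in_tuple w)).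
Qed.

End CompactSupport.

(** * One-sided powers of class C^k *)

Section Ramp.
Variable R : realType.

(** The exponent k + 1 makes the function C^k across 0: up to a constant, the derivative of
    [ramp k.+1] is [ramp k], and [ramp 0] is continuous. *)
Definition ramp (k : nat) (t : R) : R := Num.max 0 t ^+ k.+1.

Lemma ramp_ge0 k t : 0 <= ramp k t.
Proof. by rewrite exprn_ge0 // le_max lexx. Qed.

Lemma ramp_le0 k t : t <= 0 -> ramp k t = 0.
Proof. by move=> t0; rewrite /ramp max_l // expr0n. Qed.

Lemma ramp1 k : ramp k 1 = 1.
Proof. by rewrite /ramp max_r // expr1n. Qed.

Lemma ramp_neq0 k t : ramp k t != 0 -> 0 < t.
Proof. by case: (leP t 0) => // /ramp_le0 ->; rewrite eqxx. Qed.

Lemma ramp_pos k t : 0 < t -> ramp k t = t ^+ k.+1.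
Proof. by move=> t0; rewrite /ramp max_r // ltW. Qed.

Lemma continuous_ramp k : continuous (ramp k).
Proof.
have cm : continuous (fun t : R => Num.max 0 t).
  by move=> t; apply: continuous_max; [exact: cst_continuous|exact: cvg_id].
move=> t; exact: (continuous_comp (cm t) (@exprn_continuous R k.+1 _)).
Qed.

Lemma is_derive_ramp k (t : R) : is_derive t 1 (ramp k.+1) (k.+2%:R * ramp k t).
Proof.
have [t0|t0|->] := ltgtP t 0.
- rewrite ramp_le0 ?(ltW t0) // mulr0.
  have dc : is_derive t 1 (cst 0 : R -> R) 0 := is_derive_cst 0 t 1.
  refine (near_eq_is_derive _ dc).
  near=> s; rewrite ramp_le0 //; near: s.
  by apply: filterS (lt_nbhsl t0) => s /ltW.
- rewrite ramp_pos //.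
  have dX : is_derive t 1 ((@id R) ^+ k.+2) (k.+2%:R * t ^+ k.+1).
    apply: is_derive_eq (is_deriveX k.+2 (is_derive_id t 1)) _.
    by rewrite /GRing.scale /= mulr1.
  refine (near_eq_is_derive _ dX).
  near=> s; rewrite ramp_pos ?exprfctE //; near: s.
  exact: lt_nbhsr.
rewrite ramp_le0 // mulr0.
(* At 0 the difference quotient is [ramp k h] itself, which tends to 0. *)
have cv : (fun h : R => h^-1 *: ((ramp k.+1 \o shift 0) (h *: 1) - ramp k.+1 0))
    @ 0^' --> (0 : R).
  have : ramp k @ 0^' --> (0 : R).
    rewrite -[X in _ --> X](ramp_le0 k (lexx 0)).
    by apply: cvg_within_filter; exact: continuous_ramp.
  apply: cvg_trans; apply: near_eq_cvg; near=> h.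
  have h0 : h != 0 by near: h; exact: nbhs_dnbhs_neq.
  rewrite /= addr0 [h *: 1]mulr1 (ramp_le0 k.+1 (lexx 0)) subr0.
  have [hn|hp] := leP h 0; first by rewrite !ramp_le0 // scaler0.
  by rewrite !ramp_pos // /GRing.scale /= [_ ^+ k.+2]exprS mulKf.
by apply: DeriveDef; [apply/cvg_ex; exists 0|apply: cvg_lim cv].
Unshelve. all: by end_near. Qed.

Variables (n d : nat).
Local Notation M := 'M[R]_(n, d).

(** A directional derivative only sees the line through x in direction v, where the one-variable
    chain rule applies. *)
Lemma is_derive_chain (f df : R -> R) (F : M -> R) (x v : M) :
  (forall t : R, is_derive t 1 f (df t)) -> derivable F x v ->
  is_derive x v (f \o F) (df (F x) * 'D_v F x).
Proof.
move=> hf dF.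
pose g (s : R) := F (x + s *: v).
have dg : is_derive (0 : R) 1 g ('D_v F x).
  have := @is_derive_line R n d F x v 0.
  by rewrite scale0r addr0; apply.
have g0 : g 0 = F x by rewrite /g scale0r addr0.
have hg : is_derive (0 : R) 1 (f \o g) (df (F x) * 'D_v F x).
  by apply: is_derive1_comp dg; rewrite g0.
have E : (fun h : R => h^-1 *: (((f \o F) \o shift x) (h *: v) - (f \o F) x)) =
    (fun h : R => h^-1 *: (((f \o g) \o shift 0) (h *: 1) - (f \o g) 0)).
  apply/funext => h /=; rewrite g0 /g addr0 [h *: 1]mulr1.
  by rewrite [h *: v + x]addrC.
case: hg => h1 h2; apply: DeriveDef; first by rewrite /derivable E.
by rewrite /derive E.
Qed.

Lemma Ck_ramp k (U : set M) F : open U -> Ck k U F -> Ck k U (ramp k \o F).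
Proof.
move=> oU; elim: k F => [|k IH] F CF.
  split=> [x Ux|//].
  exact: (continuous_comp (Ck_continuous CF Ux) (@continuous_ramp 0 (F x))).
have CF' := CkS CF.
split=> [x Ux|v].
  exact: (continuous_comp (Ck_continuous CF Ux) (@continuous_ramp k.+1 (F x))).
have [cF /(_ v) [dv Cv]] := CF.
have hD (x : M) : U x -> is_derive x (basis_vec R v : M) (ramp k.+1 \o F)
    (k.+2%:R * ramp k (F x) * partial v F x).
  by move=> Ux; exact: (is_derive_chain (is_derive_ramp k) (dv _ Ux)).
split=> [x Ux|]; first by case: (hD x Ux).
have C1 := CkM oU (Ck_scale k.+2%:R oU (IH _ CF')) Cv.
apply: Ck_ext C1 => // y Uy.
by rewrite /partial (@derive_val _ _ _ _ _ _ _ (hD y Uy)).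
Qed.

End Ramp.

(** * Cutoffs and C^k approximation near a compact set *)

Section Cutoff.
Variables (R : realType) (n d : nat).
Local Notation M := 'M[R]_(n, d).
Local Notation crd v x := (x (vindex v).1 (vindex v).2).

Lemma uniform_neighborhood (V U : set M) : compact V -> open U -> V `<=` U ->
  exists2 r : R, 0 < r & forall x, V x -> ball x r `<=` U.
Proof.
move=> /compact_near_coveringP cV oU VU.
have : \forall r \near (0 : R)^'+, V `<=` (fun x => ball x r `<=` U).
  apply: cV => x Vx.
  have /nbhs_ballP [t /= t0 Ht] : nbhs x U by apply: open_nbhs_nbhs; split=> //; exact: VU.
  exists (ball x (t / 2), [set s | s < t / 2]).
    split; first by apply: nbhsx_ballx; rewrite divr_gt0.
    by apply: nbhs_right_lt; rewrite divr_gt0.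
  move=> [x' s] /= [xx' st] y yx'; apply: Ht.
  by rewrite [t]splitr; apply: ball_triangle xx' _; apply: le_ball yx'; exact: ltW.
move=> H; have : \forall r \near (0 : R)^'+, 0 < r /\ V `<=` (fun x => ball x r `<=` U).
  by near=> r; split; near: r => //; exact: nbhs_right_gt.
by move/filter_ex => [r [r0 Hr]]; exists r.
Unshelve. all: by end_near. Qed.

(** For r > 0 it is positive exactly on the open ball of radius r about c, a cube in the maximum
    norm. *)
Definition bump k (r : R) (c x : M) : R :=
  \prod_v ramp k (r ^+ 2 - (crd v x - crd v c) ^+ 2).

Lemma bump_ge0 k r c x : 0 <= bump k r c x.
Proof. by apply: prodr_ge0 => v _; exact: ramp_ge0. Qed.

Lemma norm_crdP (x : M) (r : R) : 0 < r ->
  (forall v : 'I_(n * d), `|crd v x| < r) -> `|x| < r.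
Proof.
move=> r0 h; rewrite -[`|x|]/(mx_norm x) mx_normrE; apply/bigmax_ltP; split=> //.
by move=> [i j] _; have := h (mxvec_index i j); rewrite vindexK.
Qed.

Lemma bump_support k r c x : 0 < r -> bump k r c x != 0 -> `|x - c| < r.
Proof.
move=> r0 /prodf_neq0 h; apply: norm_crdP => // v.
have /ramp_neq0 := h v isT; rewrite subr_gt0 !mxE -real_normK ?num_real // => hv.
by rewrite -(@ltr_pXn2r _ 2) ?nnegrE // ltW.
Qed.

Lemma bump_lower k r c x : 0 < r -> `|x - c| < r / 2 ->
  (ramp k (r ^+ 2 / 2)) ^+ (n * d) <= bump k r c x.
Proof.
move=> r0 xc; rewrite -[X in _ ^+ X]card_ord -prodr_const.
apply: ler_prod => v _; rewrite ramp_ge0 /=.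
have r2 : 0 < r ^+ 2 by rewrite exprn_gt0.
have hv : (crd v x - crd v c) ^+ 2 <= r ^+ 2 / 2.
  have h : `|crd v x - crd v c| < r / 2.
    apply: le_lt_trans xc; have := norm_crd (x - c) (vindex v).1 (vindex v).2.
    by rewrite !mxE.
  rewrite -real_normK ?num_real //; have := normr_ge0 (crd v x - crd v c).
  move: `|_| h => a h a0; nra.
rewrite !ramp_pos; [|lra|lra].
by rewrite ler_pXn2r // ?nnegrE; lra.
Qed.

Lemma Ck_bump k m U r c : open U -> (m <= k)%N -> Ck m U (bump k r c).
Proof.
move=> oU mk; apply: Ck_leq mk _; apply: Ck_prod => // v.
apply: Ck_ramp => //.
pose p : mpoly (n * d) R := mpolyC _ (r ^+ 2) -
  (mpolyX R (mnm1 v) - mpolyC _ (crd v c)) ^+ 2.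
rewrite (_ : (fun x => _) = peval p); first exact: Ck_peval.
apply/funext => x; rewrite /p /peval mevalB mevalC rmorphXn /= mevalB mevalC.
by rewrite -/(peval _ x) pevalX.
Qed.

Lemma exists_cutoff k (V U : set M) : compact V -> open U -> V `<=` U ->
  exists chi : M -> R, [/\ Ck k setT chi,
    exists U1, [/\ open U1, V `<=` U1 & forall x, U1 x -> chi x = 1],
    exists U2, [/\ open U2, ~` U `<=` U2 & forall x, U2 x -> chi x = 0] &
    exists r, vanishes_outside r chi].
Proof.
move=> cV oU VU.
have [r' r'0 Hr'] := uniform_neighborhood cV oU VU.
pose r := r' / 2; have r0 : 0 < r by rewrite divr_gt0.
have r20 : 0 < r / 2 by rewrite divr_gt0.
(* Finitely many half-size balls cover V, and on each of them its own bump is at least the constant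
   [c0] below. *)
have := cV; rewrite compact_cover => /(_ M V (fun c => ball c (r / 2))) [].
- by move=> c _; exact: ball_open.
- by move=> x Vx; exists x => //; exact: ballxx.
move=> D DV cover_D.
pose psi x := \sum_(c <- finmap.enum_fset D) bump k r c x.
pose c0 := ramp k (r ^+ 2 / 2) ^+ (n * d).
have c00 : 0 < c0.
  by rewrite exprn_gt0 // ramp_pos ?exprn_gt0 // divr_gt0 ?exprn_gt0.
(* This equals 0 where psi = 0 and 1 where psi >= c0. *)
pose chi x := 1 - ramp k (1 - c0^-1 * psi x).
have Cpsi : Ck k setT psi.
  by apply: Ck_sum; [exact: openT|move=> c _; apply: Ck_bump; [exact: openT|]].
have chi0 x : psi x = 0 -> chi x = 0.
  by move=> p0; rewrite /chi p0 mulr0 subr0 ramp1 subrr.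
have psi_supp x : psi x != 0 -> exists2 c, V c & `|x - c| < r.
  move=> px; have [c /andP[cD bx]] : exists c, (c \in finmap.enum_fset D) && (bump k r c x != 0).
    apply/not_existsP => h; move/eqP: px; apply; rewrite /psi big_seq big1 // => c cD.
    apply/eqP; apply: contraT => bx; by have := h c; rewrite cD bx => /(_ isT).
  exists c; first by have := DV c cD; rewrite inE.
  exact: bump_support bx.
exists chi; split.
- have Cc := Ck_cst k [set: M] (1 : R).
  apply: (CkB openT (Cc) (Ck_ramp openT (CkB openT (Cc) _))).
  exact: Ck_scale openT Cpsi.
- exists (\bigcup_(c in [set c | c \in finmap.enum_fset D]) ball c (r / 2)); split.
  + by apply: bigcup_open => c _; exact: ball_open.
  + exact: cover_D.
  move=> x [c cD xc]; rewrite /chi ramp_le0 ?subr0 //.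
  rewrite subr_le0 -ler_pdivrMl ?invr_gt0 // invrK mulr1.
  apply: (@le_trans _ _ (bump k r c x)).
    by apply: bump_lower => //; move: xc; rewrite -ball_normE /= distrC.
  rewrite /psi (bigD1_seq c) ?finmap.fset_uniq //= lerDl sumr_ge0 // => c' _.
  exact: bump_ge0.
(* Balls of radius r' = 2r about points of V stay in U, so a point within r of the complement of U
   is at distance at least r from V, off the support of psi. *)
- exists (\bigcup_(x in ~` U) ball x r); split.
  + by apply: bigcup_open => c _; exact: ball_open.
  + by move=> x Ux; exists x => //; exact: ballxx.
  move=> y [x nUx xy]; apply: chi0; apply/eqP; apply: contraT => /psi_supp [c Vc yc].
  case: nUx; apply: (Hr' c Vc); rewrite [r']splitr.
  apply: (@ball_triangle _ _ y); last by apply: ball_sym.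
  by rewrite -ball_normE /= distrC.
- have [B [_ HB]] := compact_bounded cV.
  exists (`|B| + 1 + r) => x xr; apply: chi0; apply/eqP; apply: contraT => /psi_supp [c Vc xc].
  have cB : `|c| <= `|B| + 1 by apply: HB => //; rewrite ltr_pwDr // ler_norm.
  have : `|x| <= `|c| + `|x - c| by have := ler_normD c (x - c); rewrite addrC subrK.
  move=> h; suff : False by [].
  lra.
Qed.

Lemma weierstrass_Ck k (V U : set M) (G : M -> R) (eps : R) :
  compact V -> open U -> V `<=` U -> Ck k U G -> 0 < eps ->
  exists p : mpoly (n * d) R, forall w, (size w <= k)%N -> forall x : M, V x ->
    `|partial_word w G x - partial_word w (peval p) x| < eps.
Proof.
move=> cV oU VU CG e0.
have [chi [Cchi [U1 [oU1 VU1 chi1]] [U2 [oU2 UU2 chi0]] [r chir]]] := exists_cutoff k cV oU VU.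
pose F : M -> R := chi * G.
have CF : Ck k setT F.
  (* Nothing is known about G outside U, but there the product is locally 0; the two open sets U and
     U2 cover the space. *)
  rewrite (_ : [set: M] = U `|` U2); last first.
    apply/seteqP; split=> // x _; have [Ux|nUx] := pselect (U x); first by left.
    by right; exact: UU2.
  apply: Ck_setU; first by apply: CkM => //; exact: Ck_subset Cchi.
  apply: Ck_ext (Ck_cst k U2 0) => // y U2y.
  by rewrite -[RHS]/(chi y * G y) chi0 // mul0r.
have F0 : vanishes_outside r F.
  by move=> x /chir chix; rewrite -[LHS]/(chi x * G x) chix mul0r.
have [B [_ HB]] := compact_bounded cV.
have L0 : 0 < `|B| + 1 by rewrite ltr_wpDl.
have [p Hp] := weierstrass_compact_support CF F0 L0 e0.
exists p => w wk x Vx.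
(* The cutoff is 1 on a neighbourhood of V, so F and G have the same derivatives on V. *)
rewrite (@open_eq_partial_word _ _ _ U1 G F w x) //; last first.
- exact: VU1.
- by move=> y /chi1 c1; rewrite -[RHS]/(chi y * G y) c1 mul1r.
by apply: Hp => //; apply: HB => //; rewrite ltr_pwDr // ler_norm.
Qed.

End Cutoff.

(** * Antisymmetric approximation *)

Section Antisymmetrization.
Variables (R : realType) (n d : nat).
Local Notation M := 'M[R]_(n, d).
Local Notation A := (mpoly (n * d) R).

Lemma row_continuous i : continuous (row i : M -> 'rV[R]_d).
Proof.
move=> x B /nbhs_ballP [e e0 es]; apply/nbhs_ballP; exists e => // y [_ xy].
by apply: es; split=> // i' j; rewrite !mxE; exact: xy.
Qed.

Lemma compact_cart_pow (Omega : set 'rV[R]_d) :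
  compact Omega -> compact (cart_pow n Omega).
Proof.
move=> cO; have [B [_ HB]] := compact_bounded cO.
apply: subclosed_compact (@compact_norm_ball R n d (`|B| + 1)) _; last first.
  move=> x Ox /=; apply/norm_leP => [|i j]; first by rewrite addr_ge0.
  have := HB (`|B| + 1) _ (row i x) (Ox i); rewrite ltr_pwDr ?ler_norm // => /(_ isT).
  by move=> h; have := le_trans (norm_crd (row i x) 0 j) h; rewrite mxE.
rewrite (_ : cart_pow n Omega = \bigcap_i (row i @^-1` Omega)); last first.
  by apply/seteqP; split=> [x Ox i _|x Ox i]; exact: Ox.
apply: closed_bigI => i _; apply: closed_comp.
  by move=> x _; exact: row_continuous.
by apply: compact_closed => //; exact: norm_hausdorff.
Qed.

Lemma cart_pow_row_perm (Omega : set 'rV[R]_d) (s : 'S_n) x :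
  cart_pow n Omega x -> cart_pow n Omega (row_perm s x).
Proof.
move=> Ox i; rewrite (_ : row i _ = row (s i) x); first exact: Ox.
by apply/rowP => j; rewrite !mxE.
Qed.

Definition antisymmetrization (F : M -> R) (x : M) : R :=
  n`!%:R^-1 * \sum_(s : 'S_n) (-1) ^+ s * F (row_perm s x).

Lemma antisymmetrization_row_perm F (t : 'S_n) x :
  antisymmetrization F (row_perm t x) = (-1) ^+ t * antisymmetrization F x.
Proof.
rewrite /antisymmetrization mulrCA; congr (_ * _); rewrite mulr_sumr.
rewrite [RHS](reindex_inj (mulIg t)) /=; apply: eq_bigr => s _.
rewrite row_permM odd_permM signr_addb [in RHS]mulrA; congr (_ * _).
by rewrite mulrCA -signr_addb addbb mulr1.
Qed.

Lemma fact_neq0 : n`!%:R != 0 :> R.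
Proof. by rewrite pnatr_eq0 -lt0n fact_gt0. Qed.

Lemma antisymmetric_mean (V : set M) (g : M -> R) x : V x ->
  antisymmetric_on V g -> antisymmetrization g x = g x.
Proof.
move=> Vx ag; rewrite /antisymmetrization (eq_bigr (fun=> g x)) => [|s _].
  by rewrite sumr_const card_Sn -[X in _ * X]mulr_natl mulKf // fact_neq0.
by rewrite ag // mulrA -signr_addb addbb mul1r.
Qed.

Lemma open_row_perm_invariant (U : set M) : open U ->
  open [set x : M | forall s : 'S_n, U (row_perm s x)].
Proof.
move=> oU; suff H (r : seq 'S_n) : open [set x : M | forall s, s \in r -> U (row_perm s x)].
  rewrite (_ : mkset _ = [set x : M | forall s, s \in enum 'S_n -> U (row_perm s x)]) //.
  by apply/seteqP; split=> x /= h s; [move=> _|]; apply: h; rewrite ?mem_enum.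
elim: r => [|t r IH].
  rewrite (_ : mkset _ = setT); first exact: openT.
  by apply/seteqP; split.
rewrite (_ : mkset _ = (row_perm t @^-1` U) `&`
    [set x : M | forall s, s \in r -> U (row_perm s x)]); last first.
  apply/seteqP; split=> x /=.
    by move=> h; split=> [|s sr]; apply: h; rewrite inE ?eqxx // sr orbT.
  by move=> [h1 h2] s; rewrite inE => /orP[/eqP ->|/h2].
apply: openI => //; apply: open_comp => // x _; exact: row_perm_continuous.
Qed.

(** The signed mean of any extension over S_n still extends g, as g is antisymmetric. It is C^k
    where all permuted points lie in U, and it is antisymmetric everywhere, so its derivatives
    inherit the relations. *)
Lemma exists_antisymmetric_extension k (Omega : set 'rV[R]_d) (g : M -> R) :
  antisymmetric_on (cart_pow n Omega) g -> Ck_on k (cart_pow n Omega) g ->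
  exists G, Ck_extension k (cart_pow n Omega) g G /\
            antisymmetric_derivatives k (cart_pow n Omega) G.
Proof.
move=> ag [F [U [oU VU CF Fg]]].
set V := cart_pow n Omega in ag VU Fg *.
pose U' := [set x : M | forall s : 'S_n, U (row_perm s x)].
have oU' : open U' := open_row_perm_invariant oU.
have VU' : V `<=` U'.
  by move=> x Vx s; apply: VU; exact: cart_pow_row_perm.
have CG : Ck k U' (antisymmetrization F).
  apply: Ck_scale => //; apply: Ck_sum => // s _; apply: Ck_scale => //.
  by apply: Ck_subset (Ck_row_perm s CF) => x Ux; exact: Ux.
exists (antisymmetrization F); split.
  exists U'; split=> // x Vx; rewrite -(antisymmetric_mean Vx ag).
  rewrite /antisymmetrization; congr (_ * _); apply: eq_bigr => s _.
  by rewrite Fg //; exact: cart_pow_row_perm.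
move=> a s x Vx.
rewrite (_ : (fun y => _) = (fun y => (-1) ^+ s * antisymmetrization F y)); last first.
  by apply/funext => y; exact: antisymmetrization_row_perm.
rewrite !partialsE (partial_wordZ _ oU' CG) //; last exact: VU'.
by rewrite size_multi_word -ltnS; case: a.
Qed.

Lemma mderiv_word_sum (w : seq 'I_(n * d)) (I : finType) (c : I -> R) (q : I -> A) :
  foldr (fun v => mderiv v) (\sum_i c i *: q i) w =
  \sum_i c i *: foldr (fun v => mderiv v) (q i) w.
Proof.
elim: w => //= v w ->; rewrite raddf_sum; apply: eq_bigr => i _.
exact: mderivZ.
Qed.

Lemma partial_word_alternant (w : seq 'I_(n * d)) (p : A) (x : M) :
  partial_word w (peval (alternant p)) x =
  \sum_(s : 'S_n) (-1) ^+ s * partial_word w (peval p \o row_perm s) x.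
Proof.
rewrite partial_word_peval /alternant mderiv_word_sum /peval raddf_sum.
apply: eq_bigr => s _ /=; rewrite mevalZ -/(peval _ x) -partial_word_peval.
congr (_ * partial_word w _ x); apply/funext => y /=.
by rewrite -peval_row_perm.
Qed.

(** The relations between the derivatives of G make each of them its own signed mean over S_n. The
    error of the antisymmetrized polynomial is therefore a signed mean of errors of [p] at the
    permuted points. *)
Lemma antisymmetric_approximation k (Omega : set 'rV[R]_d) (g G : M -> R) (eps : R) :
  compact Omega -> Ck_extension k (cart_pow n Omega) g G ->
  antisymmetric_derivatives k (cart_pow n Omega) G -> 0 < eps ->
  exists2 q : A, alternating q &
    forall (a : bmultinom (n * d) k.+1) x, cart_pow n Omega x ->
      `|partials a (fun y => G y - peval q y) x| <= eps.
Proof.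
move=> cO [U [oU VU CG _]] aG e0.
have [p Hp] := weierstrass_Ck (compact_cart_pow cO) oU VU CG e0.
exists (mpolyC _ n`!%:R^-1 * alternant p).
  move=> s; rewrite mul_mpolyC msymZ alternating_alternant !scalerA mulrC.
  by [].
move=> a x Vx; have wk : (size (multi_word a) <= k)%N.
  by rewrite size_multi_word -ltnS; case: a.
have := aG a; rewrite !partialsE; set w := multi_word a in wk * => aw.
rewrite (partial_wordB oU CG (Ck_peval _ _ _) wk (VU _ Vx)).
have -> : partial_word w (peval (mpolyC _ n`!%:R^-1 * alternant p)) x =
    n`!%:R^-1 * partial_word w (peval (alternant p)) x.
  rewrite -(partial_wordZ _ oU (Ck_peval k U (alternant p)) wk (VU _ Vx)).
  by congr (partial_word w _ x); apply/funext => y; rewrite pevalM pevalC.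
rewrite partial_word_alternant.
have -> : partial_word w G x = n`!%:R^-1 * \sum_(s : 'S_n)
    (-1) ^+ s * partial_word w (G \o row_perm s) x.
  rewrite (eq_bigr (fun=> partial_word w G x)) => [|s _].
    by rewrite sumr_const card_Sn -[X in _ * X]mulr_natl mulKf // fact_neq0.
  have := aw s x Vx; rewrite partialsE => ->.
  by rewrite mulrA -signr_addb addbb mul1r.
rewrite -mulrBr -sumrB normrM ger0_norm ?invr_ge0 // ler_pdivrMl ?ltr0n ?fact_gt0 //.
apply: le_trans (ler_norm_sum _ _ _) _.
apply: (@le_trans _ _ (\sum_(s : 'S_n) eps)); last by rewrite sumr_const card_Sn mulr_natl.
apply: ler_sum => s _; rewrite -mulrBr normrM normr_sign mul1r.
(* The relabelled word need not be in the order of [multi_word]; [p] approximates along all words of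
   length at most k. *)
rewrite !partial_word_row_perm /=; apply/ltW/Hp; first by rewrite size_map.
exact: cart_pow_row_perm.
Qed.

Lemma Ck_norm_lt k (V : set M) (F : M -> R) (eps : R) : 0 < eps ->
  (forall (a : bmultinom (n * d) k.+1) x, V x ->
     `|partials a F x| <= eps / (#|{: bmultinom (n * d) k.+1}|.+1)%:R) ->
  Ck_norm k V F < eps.
Proof.
move=> e0 H; set N := #|_| in H *.
(* The denominator is one more than the number N of multi-indices, so that N terms add up to
   strictly less than eps. *)
have dl0 : 0 < eps / N.+1%:R by rewrite divr_gt0.
rewrite /Ck_norm; apply: (@le_lt_trans _ _ (\sum_(a : bmultinom (n * d) k.+1) eps / N.+1%:R)).
  apply: ler_sum => a _.
  (* The bound on a supremum asks for a nonempty set; over the empty set [sup] takes the value 0. *)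
  have [->|/set0P [y Vy]] := eqVneq V set0.
    by rewrite image_set0 sup0 ltW.
  apply: ge_sup; first by exists `|partials a F y|, y.
  by move=> _ [x Vx <-]; exact: H.
rewrite sumr_const -[ltLHS]mulr_natl.
by rewrite mulrCA gtr_pMr // ltr_pdivrMr // mul1r ltr_nat.
Qed.

End Antisymmetrization.

Theorem mainTheorem5 (R : realType) (n d : nat) (hn : (2 <= n)%N)
    (hd : (1 <= d)%N) :
  exists K : nat, min_num_generators R n d K /\
  exists f : 'I_K -> mpoly (n * d) R,
    (forall i, antisymmetric_poly n d (f i) /\
       exists e : nat, (e <= 'C(n, 2))%N /\ f i \is ishomog1 e mdeg) /\
    forall (k : nat) (Omega : set 'rV[R]_d) (g : 'M[R]_(n, d) -> R),
      compact Omega ->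
      antisymmetric_on (cart_pow n Omega) g ->
      Ck_on k (cart_pow n Omega) g ->
      (exists G, Ck_extension k (cart_pow n Omega) g G /\
                 antisymmetric_derivatives k (cart_pow n Omega) G) /\
      forall G, Ck_extension k (cart_pow n Omega) g G ->
        antisymmetric_derivatives k (cart_pow n Omega) G ->
        forall eps : R, 0 < eps ->
        exists u : 'I_K -> mpoly (n * d) R,
          (forall i, symmetric_poly n d (u i)) /\
          Ck_norm k (cart_pow n Omega)
            (fun x => G x - peval (\sum_(i < K) u i * f i) x) < eps.
Proof.
have [K [f [genf homf minf]]] := exists_minimal_generators R n d.
exists K; split.
  split; first by exists f; apply/generates_antisymmetricP.
  by move=> m f' /generates_antisymmetricP; exact: minf.
exists f; split=> [i|k Omega g cO ag Cg].
  by split; [apply/antisymmetric_polyP; exact: genf.1|exact: homf].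
split=> [|G CG aG eps e0]; first exact: exists_antisymmetric_extension.
have dl0 : 0 < eps / (#|{: bmultinom (n * d) k.+1}|.+1)%:R by rewrite divr_gt0.
have [q aq Hq] := antisymmetric_approximation cO CG aG dl0.
(* The approximant is antisymmetric, hence exactly a combination of the generators. *)
have [u [hu qE]] := genf.2 q aq.
exists u; split=> [i|]; first by apply/symmetric_polyP.
by apply: Ck_norm_lt => // a x Vx; rewrite -qE; exact: Hq.
Qed.
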